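(* Let $n,k\ge1$. The map $\mathrm{Lift}$ on $k$-chains of non-crossing partitions of $[n]$ corresponds to promotion on $k$-Dyck paths of size $n$: $\mathrm{Lift}=\theta^{-1}\circ\partial\circ\theta$, where $\theta$ is the bijection (denoted $\mathrm{NCPtoDyck}$) from $k$-chains of non-crossing partitions of $[n]$ to $k$-Dyck paths of size $n$ described in the context.
   Context: $k$-Dyck paths. A $k$-Dyck path of size $n$ is a lattice path from $(0,0)$ to $(kn,n)$ with steps $U=(0,1)$, $R=(1,0)$, weakly above $y=x/k$, identified with its word of length $N=(k+1)n$. Its step sequence is the set of positions of its $n$ letters $U$. The toggle $t_i$ ($1\le i\le N-1$) exchanges the $i$-th and $(i+1)$-st letters if the result is a $k$-Dyck path, and otherwise fixes the path. Promotion is $\partial=t_{N-1}\cdots t_2t_1$ ($t_1$ applied first). $k$-chains. A partition of $[n]$ is non-crossing if there are no $i<j<l<m$ with $i,l$ in one block and $j,m$ in another. A $k$-chain (weighted non-crossing partition) is $\pi=(\pi_1,\dots,\pi_k)$ with each $\pi_i$ a non-crossing partition of $[n]$ and $\pi_{i+1}$ a refinement of $\pi_i$. The weight of an edge $\{u,v\}$ ($u\ne v$ in $[n]$) is the number of layers $\pi_i$ in which $u,v$ lie in the same block ($0$ if none). The bijection $\theta=\mathrm{NCPtoDyck}$ is defined recursively (a chain on any finite set of integers is relabelled order-preservingly by $[r]$). (i) If all $\pi_i$ are the partition of $[r]$ into singletons, $\theta(\pi)=(UR^k)^r$. (ii) If $\pi_1=\{[r]\}$ and $r\ge2$, let $\pi'=(\pi_2,\dots,\pi_k,\hat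 1)$ with $\hat1$ the partition into singletons; the step sequence of $\theta(\pi)$ is $\{1\}\cup\{u-1: u\ge 2,\ u \text{ in the step sequence of }\theta(\pi')\}$. (iii) In general let $B_1,\dots,B_h$ be the blocks of $\pi_1$ ordered by their minima and $\mu_i$ the path of the chain restricted to $B_i$. Start with $\mu_1$; for $i=2,\dots,h$ insert $\mu_i$ into the current path right after its first $(k+1)j$ steps, $j=\#\{p\in B_1\cup\dots\cup B_{i-1}:p<\min B_i\}$. The result is $\theta(\pi)$. The map $\mathrm{Lift}$. Given $\pi$, first increase the weights of all edges (including those of weight $0$) by one. Then delete every edge $\{u,v\}$, $u<v$, such that some block of $\pi_k$ (i.e. a set of points pairwise joined by edges of new weight $k+1$) contains both an element of $\{u+1,\dots,v\}$ and an element of $[n]\setminus\{u+1,\dots,v\}$. In particular, all edges of new weight $k+1$ are deleted. The remaining edges keep their new weights; $\mathrm{Lift}(\pi)$ is the $k$-chain whose $i$-th layer has two points in the same block iff the edge between them remains and has new weight at least $i$. Equivalently $\mathrm{Lift}(\pi)=(\kappa,\kappa\wedge\pi_1,\dots,\kappa\wedge\pi_{k-1})$, where $\kappa$ is the Kreweras complement of $\pi_k$ ($u<v$ are in the same block of $\kappa$ iff no block of $\pi_k$ meets both $\{u+1,\dots,v\}$ and its complement) and $\wedge$ denotes the common refinement (blockwise intersection). *)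

(* Defs.v *)
From HB Require Import structures.
From mathcomp Require Import all_boot zify.

Set Implicit Arguments.
Unset Strict Implicit.
Unset Printing Implicit Defensive.

(* Paths are words over bool: true is the letter U = (0,1), false is R = (1,0). *)
Notation stepU := true (only parsing).
Notation stepR := false (only parsing).

(* After i letters the path is at (x, y), with x the number of R's and y the
   number of U's read so far; "weakly above y = x/k" means x <= k * y. *)
Definition above_line (k : nat) (w : seq bool) : bool :=
  all (fun i => count_mem stepR (take i w) <= k * count_mem stepU (take i w))
      (iota 0 (size w).+1).

Definition is_kdyck (k n : nat) (w : seq bool) : bool :=
  [&& size w == k.+1 * n, count_mem stepU w == n & above_line k w].

Record kdyck (k n : nat) :=
  KDyck { dyck_word :> seq bool; dyck_wordP : is_kdyck k n dyck_word }.

HB.instance Definition _ k n := [isSub for @dyck_word k n].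
HB.instance Definition _ k n := [Countable of kdyck k n by <:].

(* Letter positions are numbered from 1, so letter i is [nth _ w i.-1]. *)
Definition letter (w : seq bool) (i : nat) : bool := nth stepR w i.-1.

Definition steps (w : seq bool) : seq nat :=
  [seq i <- iota 1 (size w) | letter w i == stepU].

Definition word_of_steps (N : nat) (S : seq nat) : seq bool :=
  [seq i \in S | i <- iota 1 N].

Definition swap_letters (i : nat) (w : seq bool) : seq bool :=
  [seq letter w (if j == i then i.+1 else if j == i.+1 then i else j)
     | j <- iota 1 (size w)].

(* [insubd p w] is the k-Dyck path with word w if w is one, and p otherwise. *)
Definition toggle (k n i : nat) (p : kdyck k n) : kdyck k n :=
  insubd p (swap_letters i p).

Definition promotion (k n : nat) (p : kdyck k n) : kdyck k n :=
  foldl (fun q i => toggle i q) p (iota 1 (k.+1 * n).-1).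

(* The ground set [n] is 'I_n, i.e. the points are numbered from 0. *)
Definition noncrossing (n : nat) (P : {set {set 'I_n}}) : bool :=
  [forall B in P, [forall C in P, (B != C) ==>
    ~~ [exists i in B, [exists l in B, [exists j in C, [exists m in C,
          [&& i < j, j < l & l < m]]]]]]].

Definition refines (n : nat) (Q P : {set {set 'I_n}}) : bool :=
  [forall B in Q, [exists C in P, B \subset C]].

Definition is_chain (n : nat) (A : {set 'I_n}) (pi : seq {set {set 'I_n}}) :=
  all (fun P => partition P A) pi && sorted (fun P Q => refines Q P) pi.

Definition is_kchain (n : nat) (pi : seq {set {set 'I_n}}) : bool :=
  is_chain [set: 'I_n] pi && all (@noncrossing n) pi.

Record kchain (k n : nat) := KChain {
  layers :> k.-tuple {set {set 'I_n}};
  layersP : is_kchain layers }.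

HB.instance Definition _ k n := [isSub for @layers k n].
HB.instance Definition _ k n := [Finite of kchain k n by <:].

(* The partition of A into singletons. *)
Definition hat1 (n : nat) (A : {set 'I_n}) : {set {set 'I_n}} :=
  [set [set a] | a in A].

Definition restrict (n : nat) (B : {set 'I_n}) (P : {set {set 'I_n}}) :=
  [set C :&: B | C in P] :\ set0.

(* The step sequence {1} U {u - 1 : u >= 2 a step}, on a path of equal length. *)
Definition shift_steps (w : seq bool) : seq bool :=
  word_of_steps (size w) (1 :: [seq u.-1 | u <- steps w & 2 <= u]).

(* The minimum of B; n is only a default value, for empty B. *)
Definition set_min (n : nat) (B : {set 'I_n}) : nat := \big[minn/n]_(i in B) i.

Definition blocks_by_min (n : nat) (P : {set {set 'I_n}}) : seq {set 'I_n} :=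
  sort (fun B C => set_min B <= set_min C) (enum P).

(* The accumulator is the current path and the union of the blocks inserted so
   far; from the accumulator ([::], set0) the first insertion yields mu_1. *)
Definition insert_block (k n : nat) (mu : {set 'I_n} -> seq bool)
    (st : seq bool * {set 'I_n}) (B : {set 'I_n}) : seq bool * {set 'I_n} :=
  let j := #|[set p in st.2 | p < set_min B]| in
  (take (k.+1 * j) st.1 ++ mu B ++ drop (k.+1 * j) st.1, st.2 :|: B).

Definition insert_blocks (k n : nat) (mu : {set 'I_n} -> seq bool)
    (Bs : seq {set 'I_n}) : seq bool :=
  (foldl (insert_block k mu) ([::], set0) Bs).1.

(* The chain pi lives on a subset A of 'I_n; the rules only use the relative
   order of the points, so no relabelling by an initial segment is needed.
   m is recursion fuel: see [NCPtoDyck_wordE] for the fuel-free equation. *)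
Fixpoint NCPtoDyck_rec (k n m : nat) (A : {set 'I_n})
    (pi : seq {set {set 'I_n}}) : seq bool :=
  if all (pred1 (hat1 A)) pi then
    flatten (nseq #|A| (stepU :: nseq k stepR))
  else if m is m'.+1 then
    if head set0 pi == [set A] then
      shift_steps (NCPtoDyck_rec k m' A (rcons (behead pi) (hat1 A)))
    else
      insert_blocks k
        (fun B => NCPtoDyck_rec k m' B [seq restrict B P | P <- pi])
        (blocks_by_min (head set0 pi))
  else [::].

(* Each split into blocks is followed by a shift of the layers (or by the
   all-singletons case), and k shifts leave only singletons. *)
Definition NCPtoDyck_word (k n : nat) (A : {set 'I_n})
    (pi : seq {set {set 'I_n}}) : seq bool :=
  NCPtoDyck_rec k (2 * size pi) A pi.

Definition weight (n : nat) (pi : seq {set {set 'I_n}}) (u v : 'I_n) : nat :=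
  count (fun P => v \in pblock P u) pi.

(* [last (hat1 setT) pi] is the last layer pi_k (pi is nonempty when k > 0). *)
Definition edge_deleted (n : nat) (pi : seq {set {set 'I_n}}) (u v : 'I_n) :=
  let inside (x : 'I_n) := minn u v < x <= maxn u v in
  [exists B in last (hat1 [set: 'I_n]) pi,
     [exists x in B, inside x] && [exists y in B, ~~ inside y]].

Definition lift_rel (n : nat) (pi : seq {set {set 'I_n}}) (i : nat) : rel 'I_n :=
  fun u v => (u == v) || ~~ edge_deleted pi u v && (i <= (weight pi u v).+1).

Definition lift_layer (n : nat) (pi : seq {set {set 'I_n}}) (i : nat) :=
  equivalence_partition (lift_rel pi i) [set: 'I_n].

Definition lift_layers (k n : nat) (pi : seq {set {set 'I_n}}) :=
  [tuple lift_layer pi i.+1 | i < k].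

Lemma same_blockP n (P : {set {set 'I_n}}) (u v : 'I_n) :
  partition P setT ->
  (v \in pblock P u) = [exists B in P, (u \in B) && (v \in B)].
Proof.
case/and3P=> /eqP cov tri _.
apply/idP/exists_inP => [uv|[B BP /andP[uB vB]]].
  have uc : u \in cover P by rewrite cov inE.
  by exists (pblock P u); rewrite ?pblock_mem // mem_pblock uc.
by rewrite (def_pblock tri BP uB).
Qed.

Lemma refines_same n (P Q : {set {set 'I_n}}) (u v : 'I_n) :
  partition P setT -> partition Q setT -> refines Q P ->
  v \in pblock Q u -> v \in pblock P u.
Proof.
move=> pP pQ /forall_inP QP; rewrite !same_blockP // => /exists_inP[B BQ].
case/andP=> uB vB; have /exists_inP[C CP BC] := QP _ BQ.
by apply/exists_inP; exists C => //; rewrite !(subsetP BC).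
Qed.

Lemma weight_geE n (pi : seq {set {set 'I_n}}) (u v : 'I_n) i :
  is_chain setT pi -> i <= size pi ->
  (i <= weight pi u v) = all (fun P => v \in pblock P u) (take i pi).
Proof.
case/andP=> ppi spi; rewrite /weight.
elim: pi i ppi spi => [|P pi IH] [|i] //= /andP[pP ppi] spi.
rewrite ltnS => ilt.
have := IH i ppi (path_sorted spi) ilt.
case: (boolP (v \in pblock P u)) => [uv|nuv] /= E; first by rewrite add1n ltnS.
apply/negbTE; apply: contra nuv; rewrite add0n => /(leq_ltn_trans (leq0n i)).
rewrite -has_count => /hasP[Q Qpi].
suff: all (fun Q => (v \in pblock Q u) ==> (v \in pblock P u)) pi.
  by move=> /allP/(_ _ Qpi)/implyP.
elim: pi P spi pP ppi {IH E ilt Qpi} => //= P' pi IH P /andP[PP' spi] pP.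
case/andP=> pP' ppi.
have P'P : (v \in pblock P' u) ==> (v \in pblock P u).
  by apply/implyP; apply: refines_same.
rewrite P'P /=; apply/allP => Q0 Q0pi; apply/implyP => uvQ0.
by apply: (implyP P'P); apply: (implyP (allP (IH _ spi pP' ppi) _ Q0pi)).
Qed.

Lemma edge_keptP n (pi : seq {set {set 'I_n}}) (u v : 'I_n) :
  reflect (forall B x y, B \in last (hat1 setT) pi -> x \in B -> y \in B ->
             (u < x) (+) (v < x) = (u < y) (+) (v < y))
          (~~ edge_deleted pi u v).
Proof.
have inE' (x : 'I_n) : (minn u v < x <= maxn u v) = (u < x) (+) (v < x).
  rewrite gtn_min leq_max; case: (ltnP u x); case: (ltnP v x) => //=; lia.
apply: (iffP idP) => [H B x y BP xB yB | H].
  apply/eqP; apply: contraNT H => ne; apply/exists_inP; exists B => //.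
  move: ne; case Ex: (_ (+) _); case Ey: (_ (+) _) => // _.
    by apply/andP; split; apply/exists_inP;
       [exists x | exists y]; rewrite ?inE' ?Ex ?Ey.
  by apply/andP; split; apply/exists_inP;
     [exists y | exists x]; rewrite ?inE' ?Ex ?Ey.
apply/negP => /exists_inP[B BP /andP[/exists_inP[x xB] + /exists_inP[y yB]]].
by rewrite !inE' (H _ _ _ BP xB yB) => ->.
Qed.

Lemma lift_relE n (pi : seq {set {set 'I_n}}) i :
  is_chain setT pi -> i < size pi ->
  forall u v, lift_rel pi i.+1 u v =
    ~~ edge_deleted pi u v && all (fun P => v \in pblock P u) (take i pi).
Proof.
move=> cpi ilt u v; rewrite /lift_rel ltnS (weight_geE _ _ cpi (ltnW ilt)).
case: eqP => //= <-; apply/esym/andP; split.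
  by apply/edge_keptP => B x y _ _ _; rewrite !addbb.
case/andP: cpi => /allP ppi _; apply/allP => P /mem_take/ppi/and3P[/eqP cov _ _].
by rewrite mem_pblock cov inE.
Qed.

Lemma lift_rel_equiv n (pi : seq {set {set 'I_n}}) i :
  is_chain setT pi -> i < size pi ->
  {in setT & &, equivalence_rel (lift_rel pi i.+1)}.
Proof.
move=> cpi ilt u v w _ _ _; split; first by rewrite /lift_rel eqxx.
rewrite !lift_relE // => /andP[/edge_keptP kuv /allP auv].
congr (_ && _).
  by apply/edge_keptP/edge_keptP => H B x y BP xB yB;
     move: (kuv B x y BP xB yB) (H B x y BP xB yB);
     do 6!case: (_ < _).
case/andP: cpi => /allP ppi _.
apply: eq_in_all => P Pi; have /and3P[_ tri _] := ppi _ (mem_take Pi).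
by rewrite (same_pblock tri (auv _ Pi)).
Qed.

Lemma lift_layer_partition n (pi : seq {set {set 'I_n}}) i :
  is_chain setT pi -> i < size pi -> partition (lift_layer pi i.+1) setT.
Proof. by move=> cpi ilt; apply/equivalence_partitionP/lift_rel_equiv. Qed.

Lemma lift_layer_same n (pi : seq {set {set 'I_n}}) i B u v :
  is_chain setT pi -> i < size pi -> B \in lift_layer pi i.+1 ->
  u \in B -> (v \in B) = lift_rel pi i.+1 u v.
Proof.
move=> cpi ilt BL uB.
have /and3P[_ tri _] := lift_layer_partition cpi ilt.
rewrite -(def_pblock tri BL uB).
by rewrite (pblock_equivalence_partition (lift_rel_equiv cpi ilt)).
Qed.

Lemma noncrossingP n (P : {set {set 'I_n}}) :
  reflect (forall B C (i l j m : 'I_n), B \in P -> C \in P ->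
             i \in B -> l \in B -> j \in C -> m \in C ->
             i < j -> j < l -> l < m -> B = C)
          (noncrossing P).
Proof.
apply: (iffP forall_inP) => H.
  move=> B C i l j m BP CP iB lB jC mC ij jl lm; apply/eqP.
  apply: contraTT (H B BP) => BC; apply/forall_inPn; exists C => //.
  rewrite BC /= negbK; apply/exists_inP; exists i => //; apply/exists_inP.
  exists l => //; apply/exists_inP; exists j => //; apply/exists_inP; exists m => //.
  by rewrite ij jl lm.
move=> B BP; apply/forall_inP => C CP; apply/implyP => /eqP BC; apply/negP.
case/exists_inP=> i iB /exists_inP[l lB /exists_inP[j jC /exists_inP[m mC]]].
by case/and3P=> ij jl lm; apply: BC; apply: H ij jl lm.
Qed.

Lemma lift_layer_noncrossing n (pi : seq {set {set 'I_n}}) i :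
  is_kchain pi -> i < size pi -> noncrossing (lift_layer pi i.+1).
Proof.
case/andP=> cpi /allP npi ilt; apply/noncrossingP.
move=> B C a c b d BL CL aB cB bC dC ab bc cd.
have pL := lift_layer_partition cpi ilt; have /and3P[_ tri _] := pL.
rewrite -(def_pblock tri BL aB) -(def_pblock tri CL bC).
apply/esym/same_pblock => //; rewrite (def_pblock tri BL aB).
rewrite (lift_layer_same _ cpi ilt BL aB).
move: cB dC; rewrite (lift_layer_same _ cpi ilt BL aB).
rewrite (lift_layer_same _ cpi ilt CL bC) !lift_relE //.
case/andP=> /edge_keptP kac /allP aac /andP[/edge_keptP kbd /allP abd].
apply/andP; split.
  apply/edge_keptP => D x y DP xD yD.
  move: (kac D x y DP xD yD) (kbd D x y DP xD yD).
  have mono z : [/\ (b < z) ==> (a < z), (c < z) ==> (b < z) & (d < z) ==> (c < z)].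
    by split; apply/implyP; apply: ltn_trans.
  move: (mono x) (mono y) => [] + + + [].
  by do 8!case: (_ < _).
case/andP: cpi => /allP ppi _; apply/allP => P Pi.
have Ppi := mem_take Pi; have pP := ppi _ Ppi.
move: (aac _ Pi) (abd _ Pi); rewrite !same_blockP //.
case/exists_inP=> X XP /andP[aX cX] /exists_inP[Y YP /andP[bY dY]].
have /noncrossingP nP := npi _ Ppi.
have XY := nP _ _ _ _ _ _ XP YP aX cX bY dY ab bc cd.
by apply/exists_inP; exists X; rewrite // aX XY.
Qed.

Lemma lift_layers_kchain k n (pi : kchain k n) : is_kchain (lift_layers k pi).
Proof.
have kpi := layersP pi; have /andP[cpi _] := kpi.
have szpi : size pi = k by rewrite size_tuple.
have kP (P : pred {set {set 'I_n}}) :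
    (forall i, i < k -> P (lift_layer pi i.+1)) -> all P (lift_layers k pi).
  by move=> H; apply/all_tnthP => i; rewrite tnth_mktuple; apply: H.
apply/andP; split; last by apply: kP => i ik; rewrite lift_layer_noncrossing ?szpi.
apply/andP; split; first by apply: kP => i ik; rewrite lift_layer_partition ?szpi.
apply/(sortedP set0) => i; rewrite size_tuple => ik.
have ntE j : j < k -> nth set0 (lift_layers k pi) j = lift_layer pi j.+1.
  by move=> jk; rewrite -(tnth_nth set0 _ (Ordinal jk)) tnth_mktuple.
rewrite !ntE //; last exact: ltnW.
have il : i < size pi by rewrite szpi ltnW.
have iSl : i.+1 < size pi by rewrite szpi.
have pS := lift_layer_partition cpi iSl; have p := lift_layer_partition cpi il.
have /and3P[/eqP cov tri _] := p.
apply/forall_inP => B BL.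
have /set0Pn[u uB] : B != set0.
  by case/and3P: pS => _ _; apply: contraNneq => <-.
apply/exists_inP; exists (pblock (lift_layer pi i.+1) u).
  by rewrite pblock_mem // cov inE.
apply/subsetP => v; rewrite (lift_layer_same _ cpi iSl BL uB).
rewrite (pblock_equivalence_partition (lift_rel_equiv cpi il)) ?inE //.
rewrite /lift_rel; case: (u == v) => //= /andP[-> /= wt].
exact: leq_trans wt.
Qed.

Definition Lift (k n : nat) (pi : kchain k n) : kchain k n :=
  KChain (lift_layers_kchain pi).

Lemma hat1_partition n (A : {set 'I_n}) : partition (hat1 A) A.
Proof.
apply/and3P; split.
- rewrite eqEsubset; apply/andP; split; apply/subsetP => x.
    by case/bigcupP=> B /imsetP[a aA ->]; rewrite inE => /eqP->.
  by move=> xA; apply/bigcupP; exists [set x]; rewrite ?inE ?imset_f.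
- apply/trivIsetP => B C /imsetP[a _ ->] /imsetP[b _ ->] ab.
  by rewrite disjoints1 inE; apply: contraNneq ab => ->.
- by apply/negP => /imsetP[a _ /setP/(_ a)]; rewrite !inE eqxx.
Qed.

Lemma refines_trans n : transitive (fun P Q : {set {set 'I_n}} => refines Q P).
Proof.
move=> Q P S QP SQ; apply/forall_inP => B /(forall_inP SQ)/exists_inP[C CQ BC].
have /exists_inP[D DP CD] := forall_inP QP _ CQ.
by apply/exists_inP; exists D => //; apply: subset_trans CD.
Qed.

Lemma hat1_refines n (A : {set 'I_n}) P : partition P A -> refines (hat1 A) P.
Proof.
case/and3P=> /eqP cov _ _; apply/forall_inP => _ /imsetP[a aA ->].
move: aA; rewrite -cov => /bigcupP[B BP aB].
by apply/exists_inP; exists B; rewrite // sub1set.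
Qed.

Lemma is_chain_shift n (A : {set 'I_n}) pi :
  is_chain A pi -> is_chain A (rcons (behead pi) (hat1 A)).
Proof.
case: pi => [|P pi] /=; first by rewrite /is_chain /= hat1_partition.
rewrite /is_chain /= all_rcons hat1_partition => /andP[/andP[_ ppi] spi].
rewrite ppi /=; move: (path_sorted spi) ppi => {P spi}; case: pi => //= P pi.
move=> spi /andP[pP ppi]; rewrite rcons_path spi /=; apply: hat1_refines.
elim: pi P pP {spi} ppi => //= Q pi IH P _ /andP[pQ ppi]; exact: IH.
Qed.

Lemma restrict_partition n (A B : {set 'I_n}) P :
  partition P A -> B \subset A -> partition (restrict B P) B.
Proof.
case/and3P=> /eqP cov tri _ BA; apply/and3P; split.
- rewrite eqEsubset; apply/andP; split; apply/subsetP => x.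
    case/bigcupP=> C; rewrite !inE => /andP[_ /imsetP[D DP ->]].
    by rewrite inE => /andP[].
  move=> xB; have := subsetP BA _ xB; rewrite -cov => /bigcupP[C CP xC].
  apply/bigcupP; exists (C :&: B); rewrite !inE ?xC ?(imset_f (fun C => C :&: B)) ?andbT //.
  by apply/set0Pn; exists x; rewrite inE xC.
- apply/trivIsetP => C D; rewrite !inE.
  case/andP=> _ /imsetP[C' C'P ->] /andP[_ /imsetP[D' D'P ->]] CD.
  have ne : C' != D' by apply: contraNneq CD => ->.
  have := trivIsetP tri _ _ C'P D'P ne; rewrite -!setI_eq0 -!subset0.
  apply: subset_trans; apply/subsetP => x; rewrite !inE.
  by case/andP=> /andP[-> _] /andP[-> _].
- by rewrite !inE eqxx.
Qed.

Lemma restrict_refines n (B : {set 'I_n}) P Q :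
  refines Q P -> refines (restrict B Q) (restrict B P).
Proof.
move=> QP; apply/forall_inP => C; rewrite !inE => /andP[n0 /imsetP[D DQ eC]].
have /exists_inP[E EP DE] := forall_inP QP _ DQ.
have CE : C \subset E :&: B by rewrite eC setSI.
apply/exists_inP; exists (E :&: B) => //; rewrite !inE (imset_f (fun C => C :&: B)) // andbT.
by apply: contraNneq n0 => e0; rewrite -subset0 -e0.
Qed.

Lemma is_chain_restrict n (A B : {set 'I_n}) pi :
  is_chain A pi -> B \subset A -> is_chain B [seq restrict B P | P <- pi].
Proof.
case/andP=> /allP ppi spi BA; apply/andP; split.
  by apply/allP => _ /mapP[P /ppi pP ->]; apply: restrict_partition pP BA.
by apply: homo_sorted spi => P Q; apply: restrict_refines.
Qed.

Lemma restrict_block n (A B : {set 'I_n}) P :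
  partition P A -> B \in P -> restrict B P = [set B].
Proof.
case/and3P=> _ tri P0 BP; apply/setP => C; rewrite !inE.
have B0 : B != set0 by apply: contraNneq P0 => <-.
apply/andP/eqP => [[C0 /imsetP[D DP eC]]|->]; last first.
  by split=> //; apply/imsetP; exists B; rewrite // setIid.
rewrite eC; case: (eqVneq D B) => [->|DB]; first by rewrite setIid.
by move: C0; rewrite eC setI_eq0 (trivIsetP tri _ _ DP BP DB).
Qed.

Lemma restrict_hat1 n (A B : {set 'I_n}) :
  B \subset A -> restrict B (hat1 A) = hat1 B.
Proof.
move=> BA; apply/setP => C; rewrite !inE; apply/andP/imsetP.
  case=> C0 /imsetP[_ /imsetP[a aA ->] eC].
  have aB : a \in B.
    by apply: contraNT C0 => aB; rewrite eC setI_eq0 disjoints1.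
  exists a => //; rewrite eC; apply/setIidPl; by rewrite sub1set.
case=> a aB ->; split; first by apply/set0Pn; exists a; rewrite inE.
apply/imsetP; exists [set a]; first by rewrite imset_f // (subsetP BA).
by apply/esym/setIidPl; rewrite sub1set.
Qed.

Lemma eq_insert_blocks k n (mu nu : {set 'I_n} -> seq bool) Bs :
  {in Bs, mu =1 nu} -> insert_blocks k mu Bs = insert_blocks k nu Bs.
Proof.
rewrite /insert_blocks; elim: Bs ([::], set0) => //= B Bs IH st H.
have -> : insert_block k mu st B = insert_block k nu st B.
  by rewrite /insert_block H ?mem_head.
apply: IH => C CBs.
by apply: H; rewrite in_cons CBs orbT.
Qed.

Lemma mem_blocks n (P : {set {set 'I_n}}) : blocks_by_min P =i P.
Proof. by move=> B; rewrite mem_sort mem_enum. Qed.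

Definition trivial_from n d (A : {set 'I_n}) (pi : seq {set {set 'I_n}}) :=
  (d <= size pi) && all (pred1 (hat1 A)) (drop d pi).

Lemma trivial_from0 n (A : {set 'I_n}) pi :
  trivial_from 0 A pi = all (pred1 (hat1 A)) pi.
Proof. by rewrite /trivial_from drop0. Qed.

Lemma trivial_from_shift n d (A : {set 'I_n}) pi :
  trivial_from d.+1 A pi -> trivial_from d A (rcons (behead pi) (hat1 A)).
Proof.
case: pi => // P pi; rewrite /trivial_from /= ltnS => /andP[dp a].
by rewrite size_rcons leqW // drop_rcons // all_rcons /= eqxx.
Qed.

Lemma trivial_from_restrict n d (A B : {set 'I_n}) pi :
  trivial_from d A pi -> B \subset A ->
  trivial_from d B [seq restrict B P | P <- pi].
Proof.
rewrite /trivial_from size_map -map_drop => /andP[-> /allP a] BA.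
apply/allP => _ /mapP[P /a/eqP-> ->] /=; by rewrite restrict_hat1.
Qed.

Definition enough_fuel n m d (A : {set 'I_n}) (pi : seq {set {set 'I_n}}) :=
  2 * d <= m + (head set0 pi == [set A]).

Lemma block_sub n (A B : {set 'I_n}) P : partition P A -> B \in P -> B \subset A.
Proof. by case/and3P=> /eqP <- _ _ BP; apply: bigcup_sup. Qed.

Lemma head_partition n (A : {set 'I_n}) pi :
  is_chain A pi -> ~~ all (pred1 (hat1 A)) pi -> partition (head set0 pi) A.
Proof. by case: pi => //= P pi /andP[/= /andP[]]. Qed.

Lemma enough_fuel_block n m d (A B : {set 'I_n}) pi :
  is_chain A pi -> ~~ all (pred1 (hat1 A)) pi -> B \in head set0 pi ->
  2 * d <= m.+1 -> enough_fuel m d B [seq restrict B P | P <- pi].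
Proof.
move=> cpi nt BP; rewrite /enough_fuel; have pP := head_partition cpi nt.
case: pi {cpi nt} BP pP => [|P pi] /= BP pP; first by rewrite inE in BP.
by rewrite (restrict_block pP BP) eqxx addn1.
Qed.

Lemma NCPtoDyck_fuel k n m1 m2 d (A : {set 'I_n}) pi :
  is_chain A pi -> trivial_from d A pi ->
  enough_fuel m1 d A pi -> enough_fuel m2 d A pi ->
  NCPtoDyck_rec k m1 A pi = NCPtoDyck_rec k m2 A pi.
Proof.
elim: m1 m2 d A pi => [|m1 IH] [|m2] [|d] A pi cpi; rewrite ?trivial_from0 /= //;
  try by move=> ->.
- by rewrite /enough_fuel; case: eqP => _; lia.
- by rewrite /enough_fuel; case: eqP => _; lia.
move=> tr f1 f2; case: (boolP (all _ pi)) => // nt.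
move: f1 f2; rewrite /enough_fuel; case: ifP => hd f1 f2.
  congr shift_steps; apply: (IH _ d); first exact: is_chain_shift.
  - exact: trivial_from_shift.
  - by rewrite /enough_fuel; apply: leq_trans (leq_addr _ _); lia.
  - by rewrite /enough_fuel; apply: leq_trans (leq_addr _ _); lia.
apply: eq_insert_blocks => B; rewrite mem_blocks => BP.
have pP := head_partition cpi nt; have BA := block_sub pP BP.
apply: (IH _ d.+1); first exact: is_chain_restrict cpi BA.
- exact: trivial_from_restrict tr BA.
- by apply: (enough_fuel_block cpi nt BP); lia.
- by apply: (enough_fuel_block cpi nt BP); lia.
Qed.

(* The three rules of the recursion, without fuel. *)
Lemma NCPtoDyck_wordE k n (A : {set 'I_n}) pi : is_chain A pi ->
  NCPtoDyck_word k A pi =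
    if all (pred1 (hat1 A)) pi then
      flatten (nseq #|A| (stepU :: nseq k stepR))
    else if head set0 pi == [set A] then
      shift_steps (NCPtoDyck_word k A (rcons (behead pi) (hat1 A)))
    else
      insert_blocks k
        (fun B => NCPtoDyck_word k B [seq restrict B P | P <- pi])
        (blocks_by_min (head set0 pi)).
Proof.
move=> cpi; rewrite {1}/NCPtoDyck_word.
case E: (2 * size pi) => [|m] /=; first by case: pi {cpi} E.
case: (boolP (all _ pi)) => // nt; case: pi cpi nt E => // P pi cpi nt E.
rewrite [size _]/= in E.
case: ifP => hd.
  congr shift_steps; apply: (@NCPtoDyck_fuel _ _ _ _ (size pi)).
  - exact: is_chain_shift.
  - by apply: trivial_from_shift; rewrite /trivial_from /= leqnn drop_oversize.
  - by apply: leq_trans (leq_addr _ _); lia.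
  - by apply: leq_trans (leq_addr _ _); rewrite size_rcons /=; lia.
apply: eq_insert_blocks => B; rewrite mem_blocks => BP.
have pP := head_partition cpi nt; have BA := block_sub pP BP.
apply: (@NCPtoDyck_fuel _ _ _ _ (size (P :: pi))).
- exact: is_chain_restrict cpi BA.
- by apply: trivial_from_restrict BA; rewrite /trivial_from leqnn drop_size.
- by apply: (enough_fuel_block cpi nt BP); rewrite /=; lia.
- by apply: leq_trans (leq_addr _ _); rewrite size_map /=; lia.
Qed.

Lemma above_lineP k w :
  reflect (forall i, count_mem stepR (take i w) <= k * count_mem stepU (take i w))
          (above_line k w).
Proof.
apply: (iffP allP) => [H i|H i _]; last exact: H.
have H' j : j <= size w -> count_mem stepR (take j w) <= k * count_mem stepU (take j w).
  by move=> jw; apply: H; rewrite mem_iota add0n ltnS.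
case: (leqP i (size w)) => iw; first exact: H'.
by have := H' _ (leqnn (size w)); rewrite take_size take_oversize // ltnW.
Qed.

Lemma count_bool (w : seq bool) :
  count_mem stepR w + count_mem stepU w = size w.
Proof. by elim: w => //= -[] w <-; lia. Qed.

Lemma is_kdyck_insert k n1 n2 s1 s2 mu :
  is_kdyck k n1 (s1 ++ s2) -> is_kdyck k n2 mu ->
  is_kdyck k (n1 + n2) (s1 ++ mu ++ s2).
Proof.
case/and3P=> /eqP sz1 /eqP c1 /above_lineP a1 /and3P[/eqP sz2 /eqP c2 /above_lineP a2].
move: sz1 c1; rewrite size_cat count_cat => sz1 c1.
apply/and3P; split; [by rewrite !size_cat mulnDr -sz1 -sz2; apply/eqP; lia
                    |by rewrite !count_cat -c1 -c2; apply/eqP; lia|].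
have e2 : count_mem stepR mu = k * count_mem stepU mu.
  by have := count_bool mu; rewrite sz2 c2; lia.
have A s : above_line k s -> count_mem stepR s <= k * count_mem stepU s.
  by move/above_lineP/(_ (size s)); rewrite take_size.
apply/above_lineP => i; rewrite take_cat.
case: ltnP => i1; first by have := a1 i; rewrite take_cat i1.
have h1 : count_mem stepR s1 <= k * count_mem stepU s1.
  by have := a1 (size s1); rewrite take_size_cat.
rewrite take_cat; case: ltnP => i2.
  have := a2 (i - size s1); rewrite !count_cat !mulnDr => h2; exact: leq_add.
have := a1 (size s1 + (i - size s1 - size mu)).
rewrite take_cat ltnNge leq_addr /= addKn !count_cat !mulnDr e2 => h2;
  by rewrite addnCA [X in _ <= X]addnCA leq_add2l.
Qed.

Lemma is_kdyck_unit k : is_kdyck k 1 (stepU :: nseq k stepR).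
Proof.
apply/and3P; rewrite /= size_nseq muln1 eqxx; split=> //.
  by rewrite count_nseq.
apply/above_lineP => -[|i] //=; rewrite add0n.
apply: leq_trans (count_size _ _) _; rewrite size_take_min size_nseq.
by rewrite mulnDr muln1; apply: leq_trans (geq_minr _ _) (leq_addr _ _).
Qed.

Lemma is_kdyck_flatten k n :
  is_kdyck k n (flatten (nseq n (stepU :: nseq k stepR))).
Proof.
elim: n => [|n IH]; first by rewrite /is_kdyck muln0.
rewrite -addn1 addnC nseqD /= -[nseq k _ ++ _]/(nseq k stepR ++ _) addnC.
exact: (@is_kdyck_insert k n 1 [::] _ _ IH (is_kdyck_unit k)).
Qed.

Lemma mem_steps w u : (u \in steps w) = (0 < u <= size w) && letter w u.
Proof. by rewrite mem_filter mem_iota add1n ltnS eqb_id andbC. Qed.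

Lemma shift_stepsE x : shift_steps (stepU :: stepR :: x) = stepU :: rcons x stepR.
Proof.
apply: (@eq_from_nth _ stepR); rewrite size_map size_iota /= ?size_rcons // => i ilt.
rewrite (nth_map 0) ?size_iota // nth_iota // add1n in_cons eqSS.
case: i ilt => [|i] //= ilt.
have -> : (i.+2 \in [seq u.-1 | u <- steps [:: true, false & x] & 2 <= u])
        = (i.+3 \in steps [:: true, false & x]).
  apply/mapP/idP => [[[|[|u]] //]|H].
    by rewrite mem_filter => /andP[_ H] /= [->].
  by exists i.+3; rewrite // mem_filter H.
rewrite mem_steps /letter /= nth_rcons !ltnS.
case: (ltnP i (size x)) => ix; first by [].
by case: ifP.
Qed.

Lemma is_kdyck_shift k n x :
  is_kdyck k n (stepU :: stepR :: x) -> is_kdyck k n (stepU :: rcons x stepR).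
Proof.
case/and3P=> /= /eqP sz /eqP c /above_lineP a; apply/and3P; split.
- by rewrite /= size_rcons sz.
- by rewrite /= -cats1 count_cat -c /=; apply/eqP; lia.
have tot : count_mem stepR (stepU :: rcons x stepR) <=
           k * count_mem stepU (stepU :: rcons x stepR).
  have := a (size x).+2; rewrite /= take_size -cats1 !count_cat /=; lia.
apply/above_lineP => -[|i] //; case: (leqP i (size x)) => ix.
  have := a i.+2; rewrite /= -cats1 takel_cat //; lia.
by rewrite take_oversize //= size_rcons ltnS.
Qed.

Lemma set_min_le n (B : {set 'I_n}) p : p \in B -> set_min B <= p.
Proof.
rewrite /set_min; have := mem_index_enum p; elim: (index_enum _) => //= x s IH.
rewrite in_cons big_cons => /orP[/eqP<- ->|ps pB]; first exact: geq_minl.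
case: ifP => _; last exact: IH.
by apply: leq_trans (IH ps pB); apply: geq_minr.
Qed.

Lemma set_min_mem n (B : {set 'I_n}) :
  B != set0 -> exists2 p, p \in B & set_min B = p :> nat.
Proof.
case/set0Pn=> q qB.
have [E|//] : set_min B = n \/ exists2 p, p \in B & set_min B = p :> nat.
  rewrite {1 2}/set_min; elim/big_rec: _ => [|p x pB IH]; first by left.
  by rewrite /minn; case: ltnP => _ //; right; exists p.
by have := set_min_le qB; rewrite E leqNgt ltn_ord.
Qed.

Lemma is_kdyck_foldl k n (mu : {set 'I_n} -> seq bool) (Bs : seq {set 'I_n})
    (st : seq bool * {set 'I_n}) :
  is_kdyck k #|st.2| st.1 -> {in Bs, forall B : {set 'I_n}, is_kdyck k #|B| (mu B)} ->
  uniq Bs -> {in Bs &, forall B C : {set 'I_n}, B != C -> [disjoint B & C]} ->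
  {in Bs, forall B : {set 'I_n}, [disjoint st.2 & B]} ->
  let st' := foldl (insert_block k mu) st Bs in
  is_kdyck k #|st'.2| st'.1 /\ st'.2 = st.2 :|: \bigcup_(B <- Bs) B.
Proof.
elim: Bs st => [|B Bs IH] st /= dst dmu; first by rewrite big_nil setU0.
case/andP=> BBs uBs dB dS.
have [] := IH (insert_block k mu st B); rewrite /insert_block /=.
- rewrite cardsU (eqP (_ : st.2 :&: B == set0)) ?cards0 ?subn0; last first.
    by rewrite setI_eq0 dS ?mem_head.
  by apply: is_kdyck_insert; rewrite ?cat_take_drop // dmu ?mem_head.
- by move=> C CBs; apply: dmu; rewrite in_cons CBs orbT.
- exact: uBs.
- by move=> C D CBs DBs; apply: dB; rewrite in_cons ?CBs ?DBs orbT.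
- move=> C CBs; rewrite -setI_eq0 setIUl setU_eq0 !setI_eq0.
  rewrite dS ?in_cons ?CBs ?orbT //= dB ?mem_head ?in_cons ?CBs ?orbT //.
  by apply: contraNneq BBs => ->.
by move=> dk e; split=> //; rewrite e big_cons setUA.
Qed.

Lemma take_foldl k n (mu : {set 'I_n} -> seq bool) (Bs : seq {set 'I_n})
    (st : seq bool * {set 'I_n}) c (p : 'I_n) :
  c <= k.+1 -> c <= size st.1 -> p \in st.2 ->
  {in Bs, forall B : {set 'I_n}, p < set_min B} ->
  take c (foldl (insert_block k mu) st Bs).1 = take c st.1.
Proof.
move=> ck; elim: Bs st => //= B Bs IH [w S] /= cw pS H.
set j := #|[set q in S | q < set_min B]|.
have j0 : 0 < j by apply/card_gt0P; exists p; rewrite inE pS H ?mem_head.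
have cj : c <= k.+1 * j by apply: leq_trans ck _; rewrite leq_pmulr.
have ct : c <= size (take (k.+1 * j) w).
  by rewrite size_take; case: ltnP.
rewrite IH /insert_block /= -/j; first by rewrite takel_cat // take_takel.
- by rewrite size_cat; apply: leq_trans ct (leq_addr _ _).
- by rewrite inE pS.
by move=> C CBs; apply: H; rewrite in_cons CBs orbT.
Qed.

Lemma blocks_by_min_head n (P : {set {set 'I_n}}) B Bs :
  trivIset P -> set0 \notin P -> blocks_by_min P = B :: Bs ->
  exists2 p, p \in B & {in Bs, forall C : {set 'I_n}, p < set_min C}.
Proof.
move=> tri P0 E.
have BP : B \in P by rewrite -mem_blocks E mem_head.
have n0 C : C \in P -> C != set0 by move=> CP; apply: contraNneq P0 => <-.
have [p pB minB] := set_min_mem (n0 _ BP); exists p => // C CBs.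
have CP : C \in P by rewrite -mem_blocks E in_cons CBs orbT.
have BC : B != C.
  have : uniq (blocks_by_min P) by rewrite sort_uniq enum_uniq.
  by rewrite E /= => /andP[+ _]; apply: contraNneq => ->.
have [q qC minC] := set_min_mem (n0 _ CP).
rewrite minC ltn_neqAle; apply/andP; split.
  have := disjointFr (trivIsetP tri _ _ BP CP BC) pB.
  by apply: contraFneq => /val_inj->.
have tot : total (fun X Y : {set 'I_n} => set_min X <= set_min Y).
  by move=> X Y; apply: leq_total.
have := sort_sorted tot (enum P); rewrite -/(blocks_by_min P) E /=.
move/(order_path_min (fun Y X Z => @leq_trans _ _ _))/allP/(_ C CBs).
by rewrite minB minC.
Qed.

Lemma is_kdyck_NCPtoDyck_rec k n m d (A : {set 'I_n}) pi :
  is_chain A pi -> size pi = k -> trivial_from d A pi -> enough_fuel m d A pi ->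
  let w := NCPtoDyck_rec k m A pi in
  is_kdyck k #|A| w /\
  (A != set0 -> take (k - d).+1 w = stepU :: nseq (k - d) stepR).
Proof.
elim: m d A pi => [|m IH] d A pi cpi szpi tr fu; last first.
  case: (boolP (all (pred1 (hat1 A)) pi)) => [al|nt] /=.
    rewrite al; split=> [|A0]; first exact: is_kdyck_flatten.
    move: A0; rewrite -card_gt0; case: #|A| => // a _ /=.
    by rewrite takel_cat ?size_nseq ?leq_subr // take_nseq ?leq_subr.
  rewrite (negbTE nt); case: d tr fu => [|d] tr fu.
    by rewrite trivial_from0 (negbTE nt) in tr.
  have dk : d < k by case/andP: tr; rewrite szpi.
  case: ifP => hd.
    have [||||dw tw] := IH d A (rcons (behead pi) (hat1 A)).
    - exact: is_chain_shift.
    - by rewrite size_rcons size_behead szpi prednK // (leq_ltn_trans _ dk).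
    - exact: trivial_from_shift.
    - by move: fu; rewrite /enough_fuel hd; lia.
    have kd : k - d = (k - d.+1).+1 by lia.
    case: (eqVneq A set0) => [A0|A0].
      case/and3P: dw; rewrite A0 cards0 muln0 size_eq0 => /eqP-> _ _.
      by split; rewrite ?eqxx // /is_kdyck ?cards0 muln0.
    move: dw (tw A0); rewrite kd; set w' := NCPtoDyck_rec _ _ _ _.
    move=> dw tw'; have [x ew tx] : exists2 x, w' = stepU :: stepR :: x
        & take (k - d.+1) x = nseq (k - d.+1) stepR.
      by case: w' tw' {dw} => [|[] [|[] x]] //= [tx]; exists x.
    rewrite ew in dw *; rewrite shift_stepsE; split; first exact: is_kdyck_shift.
    move=> _; rewrite [LHS]/=; congr cons; rewrite -cats1 takel_cat //.
    by move/(congr1 size): tx; rewrite size_take size_nseq; case: ltnP; lia.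
  have pP := head_partition cpi nt; have /and3P[/eqP cov tri P0] := pP.
  set P := head set0 pi in pP cov tri P0 hd *.
  set mu := (fun B => _); set Bs := blocks_by_min P.
  have muP B : B \in P -> is_kdyck k #|B| (mu B) /\
      take (k - d.+1).+1 (mu B) = stepU :: nseq (k - d.+1) stepR.
    move=> BP; have BA := block_sub pP BP.
    have B0 : B != set0 by apply: contraNneq P0 => <-.
    have [||||dw tw] := IH d.+1 B [seq restrict B Q | Q <- pi].
    - exact: is_chain_restrict cpi BA.
    - by rewrite size_map.
    - exact: trivial_from_restrict tr BA.
    - apply: (enough_fuel_block cpi nt BP).
      by move: fu; rewrite /enough_fuel hd addn0.
    by split; last exact: tw.
  have BsP B : B \in Bs -> B \in P by rewrite mem_blocks.
  have [||||| dw eS] := @is_kdyck_foldl k n mu Bs ([::], set0).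
  - by rewrite /is_kdyck cards0 muln0.
  - by move=> B /BsP/muP[].
  - by rewrite sort_uniq enum_uniq.
  - by move=> B C /BsP BP /BsP CP; apply: (trivIsetP tri).
  - by move=> B _; rewrite -setI_eq0 set0I.
  split.
    suff <- : (foldl (insert_block k mu) ([::], set0) Bs).2 = A by [].
    rewrite eS set0U -cov /cover (perm_big (enum P)) ?big_enum //=.
    exact: permEl (perm_sort _ _).
  move=> A0; rewrite /insert_blocks; case E: Bs => [|B Bs'].
    case/set0Pn: A0 => x; rewrite -cov => /bigcupP[B].
    by rewrite -mem_blocks -/Bs E.
  have [p pB pmin] := blocks_by_min_head tri P0 E.
  have BP : B \in P by apply: BsP; rewrite E mem_head.
  have [dB tB] := muP _ BP.
  rewrite /= -tB; rewrite (@take_foldl k n mu Bs' _ _ p) //=.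
  - by rewrite cats0.
  - by rewrite ltnS leq_subr.
  - rewrite cats0; move/(congr1 size): tB; rewrite /= size_nseq => <-.
    by rewrite size_take_min geq_minr.
  - by rewrite inE pB orbT.
have fuel0 : d = 0 \/ d.+1 = 1 by move: fu; rewrite /enough_fuel; case: eqP; lia.
have d0 : d = 0 by case: fuel0 => //; case.
rewrite d0 trivial_from0 in tr *; rewrite /= tr; split.
  exact: is_kdyck_flatten.
move=> A0; move: A0; rewrite -card_gt0; case: #|A| => // a _ /=.
by rewrite subn0 takel_cat ?size_nseq // take_nseq.
Qed.

Lemma NCPtoDyck_kdyck k n (pi : kchain k n) :
  is_kdyck k n (NCPtoDyck_word k [set: 'I_n] pi).
Proof.
have /andP[cpi _] := layersP pi.
have [|||+ _] := @is_kdyck_NCPtoDyck_rec k n (2 * size pi) k setT pi cpi.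
- by rewrite size_tuple.
- by rewrite /trivial_from size_tuple leqnn drop_oversize ?size_tuple.
- by rewrite /enough_fuel size_tuple leq_addr.
by rewrite cardsT card_ord.
Qed.

Definition NCPtoDyck (k n : nat) (pi : kchain k n) : kdyck k n :=
  KDyck (NCPtoDyck_kdyck pi).

(* Main.v *)
Require Import Defs.
From mathcomp Require Import all_boot zify.

(** Number the letters of a word from 0 and the points from 0 to n-1.  The
    proof rests on a formula for the bijection that does not recurse.  Add to a
    chain the two trivial layers: layer 0 has one block, layer k+1 has only
    singletons.  For a point p > 0 let i be the last layer in which p is not
    the minimum of its block, and q the predecessor of p in that block.  Then
    p contributes to the path the up step
      (k+1) q + (k+1 - i)        (and p = 0 contributes the up step 0),
    and these are all the up steps.  Each of the three rules of the recursion
    respects this formula: it is [realizes_trivial] for the chain of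
    singletons; shifting the layers lowers i by one and the letter number rises
    by one ([realizes_shift]); and a block that is inserted is contiguous in
    the union of the blocks inserted so far, since the layer is non-crossing,
    so that insertion only translates letter numbers ([realizes_insert]).

    From the formula the bijection follows by induction on n.  A factor U R^k
    can be inserted at any place (k+1) m - i with 0 <= i <= k, and the effect
    on chains is to add a point m which is a twin of m-1 in the layers up to i
    and isolated in the later ones ([word_add]).  Every path is obtained in
    this way from a shorter one, because its last up step is followed by k
    right steps ([word_surj]); and the last up step of a path always comes from
    such a point, so the chain can be read off the path ([last_step],
    [word_inj]).

    Promotion carries the first U to the right until the next swap would leave
    the region above the line, and from there on it carries an R to the end.
    So a path U v1 R v2, with v1 the longest admissible prefix, is sent to
    v1 U v2 R ([promotion_word]).  By the formula v1 has (k+1) M letters, where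
    M is the maximum of the block of 0 in the last layer ([word_split]).  So
    promotion lowers every up step other than 0 by one and replaces 0 by
    (k+1) M.  The same happens under Lift: if p > 0 is the minimum of its block
    in the last layer, the up step of the maximum of that block in the lifted
    chain is the one of p lowered by one; if p is not the minimum, its
    predecessor in that block has this property; and M becomes the minimum of
    its block of the Kreweras complement ([lift_step], [lift_step_zero]). *)

Set Implicit Arguments.
Unset Strict Implicit.
Unset Printing Implicit Defensive.

(** * Up steps from the recursion *)

(** Past the end of the chain the default [hat1] applies, so layer [k+1] and the
    later ones consist of singletons; this makes the rules uniform. *)
Definition linked n (pi : seq {set {set 'I_n}}) (i : nat) (x y : 'I_n) :=
  [exists C in nth (hat1 [set: 'I_n]) pi i.-1, (x \in C) && (y \in C)].

Definition rank n (A : {set 'I_n}) (x : nat) : nat := #|[set q in A | q < x]|.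

(** The letter number of the up step of [p] in the path of a chain on [A], the
    points being counted by their rank in [A].  The first case is the one of
    layer 0: the predecessor of [p] in [A] has rank one less, and the formula
    gives the multiple of [k+1] written here. *)
Definition step_of k n (A : {set 'I_n}) (pi : seq {set {set 'I_n}})
    (p : 'I_n) (y : nat) : Prop :=
  (y = k.+1 * rank A p /\
     forall x : 'I_n, x \in A -> x < p -> ~~ linked pi 1 x p) \/
  exists (i : nat) (q : 'I_n),
    [/\ 0 < i <= k, q \in A, q < p & linked pi i q p] /\
    [/\ forall x : 'I_n, x \in A -> q < x < p -> ~~ linked pi i x p,
        forall x : 'I_n, x \in A -> x < p -> ~~ linked pi i.+1 x p
      & y = k.+1 * rank A q + (k.+1 - i)].

Lemma linked_hat1 n (x y : 'I_n) (A : {set 'I_n}) : x \in A ->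
  [exists C in hat1 A, (x \in C) && (y \in C)] = (x == y).
Proof.
move=> xA; apply/exists_inP/eqP => [[_ /imsetP[a _ ->]]|<-].
  by rewrite !inE => /andP[/eqP-> /eqP->].
by exists [set x]; rewrite ?inE ?eqxx // imset_f.
Qed.

Lemma linked_over n (pi : seq {set {set 'I_n}}) i x y :
  size pi < i -> linked pi i x y = (x == y).
Proof.
case: i => // i; rewrite ltnS /linked /= => ?.
by rewrite nth_default // linked_hat1 ?inE.
Qed.

Lemma linked_restrict n (pi : seq {set {set 'I_n}}) (B : {set 'I_n}) i x y :
  x \in B -> y \in B ->
  linked [seq restrict B P | P <- pi] i x y = linked pi i x y.
Proof.
move=> xB yB; rewrite /linked; case: (ltnP i.-1 (size pi)) => ipi; last first.
  by rewrite !nth_default ?size_map.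
rewrite (nth_map (hat1 setT)) //; apply/exists_inP/exists_inP => -[C].
  rewrite !inE => /andP[_ /imsetP[D DP ->]]; rewrite !inE xB yB !andbT => H.
  by exists D.
move=> CP /andP[xC yC]; exists (C :&: B); rewrite !inE ?xC ?xB ?yC ?yB //.
rewrite (imset_f (fun C => C :&: B)) // andbT.
by apply/set0Pn; exists x; rewrite inE xC.
Qed.

Lemma linked_shift n (pi : seq {set {set 'I_n}}) (A : {set 'I_n}) i x y :
  pi != [::] -> x \in A -> 0 < i ->
  linked (rcons (behead pi) (hat1 A)) i x y = linked pi i.+1 x y.
Proof.
case: pi => // P pi _ xA; case: i => // i _; rewrite /linked /= nth_rcons.
case: ltngtP => // [lt|->]; first by rewrite nth_default // ltnW.
by rewrite nth_default // !linked_hat1 ?inE.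
Qed.
Lemma linked_sym n (pi : seq {set {set 'I_n}}) i x y :
  linked pi i x y = linked pi i y x.
Proof. by rewrite /linked; apply: eq_existsb => C; rewrite [(x \in C) && _]andbC. Qed.

Lemma nth_partition n (A : {set 'I_n}) pi i :
  is_chain A pi -> i < size pi -> partition (nth (hat1 [set: 'I_n]) pi i) A.
Proof. by case/andP=> /allP H _ ipi; apply/H/mem_nth. Qed.

Lemma linked_mono n (A : {set 'I_n}) pi i x y :
  is_chain A pi -> x \in A -> 0 < i -> linked pi i.+1 x y -> linked pi i x y.
Proof.
move=> cpi xA; case: i => // i _; case: (ltngtP i.+1 (size pi)) => ipi.
- case/andP: cpi => _ /(sortedP (hat1 setT))/(_ _ ipi) /forall_inP R.
  case/exists_inP=> C CP /andP[xC yC].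
  have /exists_inP[D DP /subsetP CD] := R _ CP.
  by apply/exists_inP; exists D; rewrite // !CD.
- by rewrite !linked_over // ltnW.
rewrite linked_over -?ipi // => /eqP<-; rewrite /linked /=.
have : x \in cover (nth (hat1 setT) pi i).
  by have /and3P[/eqP-> _ _] : partition (nth (hat1 setT) pi i) A
    by rewrite nth_partition // -ipi.
by case/bigcupP=> C CP xC; apply/exists_inP; exists C; rewrite ?xC.
Qed.

Lemma linked_le n (A : {set 'I_n}) pi i j x y :
  is_chain A pi -> x \in A -> 0 < i <= j -> linked pi j x y -> linked pi i x y.
Proof.
move=> cpi xA /andP[i0]; elim: j => [|j IH]; first by case: i i0.
rewrite leq_eqVlt => /orP[/eqP->//|]; rewrite ltnS => ij /(linked_mono cpi xA).
by move=> H; apply: IH => //; apply: H; apply: leq_trans ij.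
Qed.

Lemma rankU n (S B : {set 'I_n}) x :
  [disjoint S & B] -> rank (S :|: B) x = rank S x + rank B x.
Proof.
move=> dSB; rewrite /rank.
have -> : [set q in S :|: B | q < x] = [set q in S | q < x] :|: [set q in B | q < x].
  by apply/setP => q; rewrite !inE andb_orl.
rewrite cardsU [X in _ - X](_ : _ = 0) ?subn0 //.
apply/eqP; rewrite cards_eq0 -subset0; apply/subsetP => q; rewrite !inE.
by case/andP=> /andP[qS _] /andP[qB _]; rewrite (disjointFr dSB qS) in qB.
Qed.

Lemma rank_le_card n (A : {set 'I_n}) x : rank A x <= #|A|.
Proof. by apply/subset_leq_card/subsetP => q; rewrite inE => /andP[]. Qed.

Lemma rank_mono n (A : {set 'I_n}) x y : x <= y -> rank A x <= rank A y.
Proof.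
move=> xy; apply/subset_leq_card/subsetP => q; rewrite !inE => /andP[-> qx] /=.
exact: leq_trans xy.
Qed.

Lemma rank_mono_lt n (A : {set 'I_n}) (x : 'I_n) y :
  x \in A -> x < y -> rank A x < rank A y.
Proof.
move=> xA xy; apply/proper_card/properP; split.
  by apply/subsetP => q; rewrite !inE => /andP[-> qx]; apply: ltn_trans xy.
by exists x; rewrite !inE xA ?ltnn.
Qed.

Lemma rank_next n (A : {set 'I_n}) (q p : 'I_n) :
  q \in A -> q < p -> (forall x : 'I_n, x \in A -> ~~ (q < x < p)) ->
  rank A p = (rank A q).+1.
Proof.
move=> qA qp H; rewrite /rank (cardsD1 q) !inE qA qp add1n; congr _.+1.
apply: eq_card => x; rewrite !inE -val_eqE /=.
case: (boolP (x \in A)) => xA; rewrite ?andbF //=; have := H _ xA; lia.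
Qed.

Lemma rank_min n (A : {set 'I_n}) (p : nat) :
  (forall x : 'I_n, x \in A -> ~~ (x < p)) -> rank A p = 0.
Proof.
move=> H; apply/eqP; rewrite cards_eq0 -subset0; apply/subsetP => x.
by rewrite !inE => /andP[/H/negbTE->].
Qed.

Section Insert.
Variables (T : Type) (d : T) (w mu : seq T) (a : nat).
Hypothesis aw : a <= size w.
Let ins := take a w ++ mu ++ drop a w.

Lemma nth_insert_lt y : y < a -> nth d ins y = nth d w y.
Proof.
by move=> ya; rewrite nth_cat size_takel // ya nth_take.
Qed.

Lemma nth_insert_in y : y < size mu -> nth d ins (a + y) = nth d mu y.
Proof.
by move=> ym; rewrite nth_cat size_takel // ltnNge leq_addr /= addKn nth_cat ym.
Qed.

Lemma nth_insert_ge y : a <= y -> nth d ins (y + size mu) = nth d w y.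
Proof.
move=> ay; rewrite nth_cat size_takel // ifF; last by lia.
rewrite nth_cat ifF; last by lia.
by rewrite nth_drop; congr nth; lia.
Qed.
End Insert.

Lemma nth_true (w : seq bool) y : nth false w y -> y < size w.
Proof. by case: ltnP => // h; rewrite nth_default. Qed.

(** What non-crossing blocks of the first layer look like when [B] is inserted
    after [S]: no point of [S] lies between two points of [B]. *)
Definition separated n (pi : seq {set {set 'I_n}}) (S B : {set 'I_n}) :=
  [/\ [disjoint S & B],
      forall x y, x \in S -> y \in B -> ~~ linked pi 1 x y
    & forall x y : 'I_n, x \in S -> y \in B -> set_min B < x -> y < x].

(** Only one inclusion is recorded: the number of up steps is known, so it
    will suffice that every point contributes one. *)
Definition realizes k n (pi : seq {set {set 'I_n}}) (A : {set 'I_n}) w :=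
  size w = k.+1 * #|A| /\
  forall p y, p \in A -> step_of k A pi p y -> nth false w y.

(** As [B] has no point of [S] in between, the rank of a point of [B] grows by
    the same [j] for all of them, and the rank of a point of [S] grows by 0 or
    by [#|B|], according to its side of [B].  The letter numbers move by [k+1]
    times as much, which is what inserting the word of [B] does. *)
Lemma realizes_insert k n (pi : seq {set {set 'I_n}}) mu
    (st : seq bool * {set 'I_n}) (B : {set 'I_n}) :
  (forall i x y, 0 < i -> x \in st.2 :|: B -> linked pi i x y -> linked pi 1 x y) ->
  separated pi st.2 B -> B != set0 ->
  realizes k pi st.2 st.1 -> realizes k pi B (mu B) ->
  realizes k pi (insert_block k mu st B).2 (insert_block k mu st B).1.
Proof.
case: st => w S /= mono [dSB nl gt] B0 [sw Hw] [sm Hm].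
have [b bB mB] := set_min_mem B0; rewrite /insert_block /= -/(rank S (set_min B)) mB.
set j := rank S b.
have aw : k.+1 * j <= size w by rewrite sw leq_mul2l rank_le_card orbT.
have bmin q : q \in B -> b <= q by move=> qB; rewrite -mB set_min_le.
have rSB (q : 'I_n) : q \in B -> rank S q = j.
  move=> qB; apply: eq_card => x; rewrite !inE; case: (boolP (x \in S)) => //= xS.
  have xb : x != b by apply: contraTneq bB => <-; rewrite (disjointFr dSB xS).
  have := bmin _ qB; have := gt _ _ xS qB; rewrite mB; move: xb; rewrite -val_eqE /=; lia.
(* The letters with number below [k.+1 * j] belong to the points before [b]. *)
have rBS (q : 'I_n) : q \in S ->
    (q < b) /\ (rank B q = 0) /\ rank S q < j \/
    (b < q) /\ rank B q = #|B| /\ j <= rank S q.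
  move=> qS.
  have xb : q != b by apply: contraTneq bB => <-; rewrite (disjointFr dSB qS).
  move: xb; rewrite -val_eqE /= neq_ltn => /orP[] h; [left|right]; split=> //; split.
  - by apply: rank_min => x /bmin; lia.
  - exact: rank_mono_lt.
  - apply: eq_card => x; rewrite !inE; case: (boolP (x \in B)) => //= xB.
    by rewrite (gt _ _ qS xB) // mB.
  - by apply: rank_mono; apply: ltnW.
split.
  rewrite !size_cat size_takel // size_drop sm cardsU (eqP (_ : S :&: B == set0)) ?setI_eq0 //.
  by rewrite cards0 subn0 mulnDr -sw; lia.
move=> p y; rewrite inE => /orP[pS|pB].
- have [pB rp] : p \notin B /\ True by rewrite (disjointFr dSB pS).
  case=> [[-> min]|[i [q [[ik qSB qp lqp] [nx np ->]]]]].
    have H : nth false w (k.+1 * rank S p).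
      apply: (Hw p) => //; left; split=> // x xS xp; apply: min => //.
      by rewrite inE xS.
    rewrite rankU //; case: (rBS _ pS) => [[_ [-> lt]]|[_ [-> ge]]].
      by rewrite addn0 nth_insert_lt // ltn_pmul2l.
    by rewrite mulnDr -sm nth_insert_ge // leq_mul2l ge orbT.
  have qS : q \in S.
    move: qSB; rewrite inE => /orP[//|qB].
    have /negP[] := nl _ _ pS qB; rewrite linked_sym; apply: mono lqp => //; first by case/andP: ik.
    by rewrite inE qB orbT.
  have H : nth false w (k.+1 * rank S q + (k.+1 - i)).
    apply: (Hw p) => //; right; exists i, q; split=> //; split=> // x xS.
      by apply: nx; rewrite inE xS.
    by apply: np; rewrite inE xS.
  rewrite rankU //; case: (rBS _ qS) => [[_ [-> lt]]|[_ [-> ge]]].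
    rewrite addn0 nth_insert_lt //.
    have : k.+1 * (rank S q).+1 <= k.+1 * j by rewrite leq_mul2l lt orbT.
    by rewrite mulnS; lia.
  rewrite mulnDr -sm addnAC nth_insert_ge //.
  by apply: leq_trans (leq_addr _ _); rewrite leq_mul2l ge orbT.
- case=> [[-> min]|[i [q [[ik qSB qp lqp] [nx np ->]]]]].
    have H : nth false (mu B) (k.+1 * rank B p).
      apply: (Hm p) => //; left; split=> // x xB xp; apply: min => //.
      by rewrite inE xB orbT.
    by rewrite rankU // rSB // mulnDr nth_insert_in // nth_true.
  have qB : q \in B.
    move: qSB; rewrite inE => /orP[qS|//].
    have /negP[] := nl _ _ qS pB; apply: mono lqp => //; first by case/andP: ik.
    by rewrite inE qS.
  have H : nth false (mu B) (k.+1 * rank B q + (k.+1 - i)).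
    apply: (Hm p) => //; right; exists i, q; split=> //; split=> // x xS.
      by apply: nx; rewrite inE xS orbT.
    by apply: np; rewrite inE xS orbT.
  by rewrite rankU // rSB // mulnDr -addnA nth_insert_in // nth_true.
Qed.

Lemma realizes_foldl k n (A : {set 'I_n}) (pi : seq {set {set 'I_n}})
    mu (Bs : seq {set 'I_n}) (st : seq bool * {set 'I_n}) :
  (forall i x y, 0 < i -> x \in A -> linked pi i x y -> linked pi 1 x y) ->
  st.2 \subset A ->
  (forall B, B \in Bs -> [/\ B \subset A, B != set0, separated pi st.2 B
                           & realizes k pi B (mu B)]) ->
  (forall B C s1 s2, Bs = s1 ++ B :: s2 -> C \in s2 -> separated pi B C) ->
  realizes k pi st.2 st.1 ->
  let st' := foldl (insert_block k mu) st Bs in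
  realizes k pi st'.2 st'.1.
Proof.
move=> mono; elim: Bs st => //= B Bs IH st SA H1 H2 H3.
have [BA B0 sB rB] := H1 _ (mem_head _ _).
have SBA : st.2 :|: B \subset A by rewrite subUset SA.
apply: IH => // [C CBs|C D s1 s2 E|]; last first.
  apply: realizes_insert => // i x y i0 xS; apply: mono => //.
  exact: (subsetP SBA).
- by apply: (H2 _ _ (B :: s1)); rewrite E.
have [CA C0 [d1 l1 g1] rC] := H1 C (mem_behead (s := _ :: _) CBs).
have [d2 l2 g2] := H2 _ _ [::] _ erefl CBs.
split=> //; split=> /=.
- by rewrite -setI_eq0 setIUl setU_eq0 !setI_eq0 d1.
- by move=> x y; rewrite inE => /orP[]; [apply: l1|apply: l2].
- by move=> x y; rewrite inE => /orP[]; [apply: g1|apply: g2].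
Qed.

Definition nc_on n (A : {set 'I_n}) (pi : seq {set {set 'I_n}}) :=
  forall i (a b c d : 'I_n), 0 < i -> a \in A -> b \in A -> c \in A -> d \in A ->
    a < b -> b < c -> c < d -> linked pi i a c -> linked pi i b d -> linked pi i a b.

Lemma nth_flatten_unit k a j :
  j < a -> nth false (flatten (nseq a (stepU :: nseq k stepR))) (k.+1 * j).
Proof.
elim: a j => // a IH [|j] ja; rewrite ?muln0 //.
by rewrite mulnS [nseq _ _]/= [flatten _]/= addSn /= nth_cat size_nseq ltnNge leq_addr addKn IH.
Qed.

Lemma nth_shift_steps w y :
  nth false w y.+1 -> nth false (shift_steps w) y.
Proof.
move=> H; have yw := nth_true H; rewrite /shift_steps /word_of_steps.
rewrite (nth_map 0) ?size_iota 1?ltnW // nth_iota 1?ltnW // add1n inE.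
apply/orP; right; apply/mapP; exists y.+2 => //.
by rewrite mem_filter mem_steps /letter /= yw.
Qed.

Lemma nth_shift_steps0 w : 0 < size w -> nth false (shift_steps w) 0.
Proof. by move=> w0; rewrite (nth_map 0) ?size_iota // nth_iota. Qed.

Lemma step_of_restrict k n (B : {set 'I_n}) pi p y : p \in B ->
  step_of k B pi p y -> step_of k B [seq restrict B P | P <- pi] p y.
Proof.
move=> pB [[-> H]|[i [q [[ik qB qp lqp] [nx np ->]]]]]; [left|right].
  by split=> // x xB; rewrite linked_restrict //; apply: H.
exists i, q; split; [split=> //; by rewrite linked_restrict|split=> // x xB].
  by rewrite linked_restrict //; apply: nx.
by rewrite linked_restrict //; apply: np.
Qed.

Lemma realizes_restrict k n (B : {set 'I_n}) pi w :
  realizes k [seq restrict B P | P <- pi] B w -> realizes k pi B w.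
Proof. by case=> s H; split=> // p y pB /(step_of_restrict pB); apply: H. Qed.

Lemma realizes_trivial k n (A : {set 'I_n}) pi :
  all (pred1 (hat1 A)) pi ->
  realizes k pi A (flatten (nseq #|A| (stepU :: nseq k stepR))).
Proof.
move=> /allP al; split.
  by have /and3P[/eqP] := is_kdyck_flatten k #|A|.
have lE i x p : x \in A -> linked pi i x p = (x == p).
  move=> xA; rewrite /linked; case: (ltnP i.-1 (size pi)) => h; last first.
    by rewrite nth_default // linked_hat1 ?inE.
  by rewrite (eqP (al _ (mem_nth _ h))) linked_hat1.
move=> p y pA [[-> _]|[i [q [[_ qA qp]]]]].
  apply: nth_flatten_unit; rewrite (leq_trans (rank_mono_lt pA (ltn_ord p))) //.
  exact: rank_le_card.
by rewrite lE // => /eqP eqp; rewrite eqp ltnn in qp.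
Qed.

(** In layer [i+1] of the old chain and layer [i] of the new one the
    predecessors are the same.  The points whose last layer was the first one
    become minima everywhere; their predecessor was the previous point of [A]. *)
Lemma realizes_shift k n (A : {set 'I_n}) pi w :
  is_chain A pi -> size pi = k -> ~~ all (pred1 (hat1 A)) pi ->
  head set0 pi = [set A] ->
  realizes k (rcons (behead pi) (hat1 A)) A w -> realizes k pi A (shift_steps w).
Proof.
move=> cpi szpi nt hd [sw H]; split; first by rewrite size_map size_iota.
have pi0 : pi != [::] by case: pi nt {cpi szpi hd H}.
have l1 x p : x \in A -> p \in A -> linked pi 1 x p.
  move=> xA pA; apply/exists_inP; exists A; rewrite ?xA // -/(nth _ _ _).
  by case: pi hd {cpi szpi nt H} pi0 => //= P pi -> _; rewrite inE.
have lS i x p : x \in A -> 0 < i ->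
    linked (rcons (behead pi) (hat1 A)) i x p = linked pi i.+1 x p.
  by move=> xA i0; apply: linked_shift.
move=> p y pA [[-> min]|[i [q [[/andP[i0 ik] qA qp lqp] [nx np ->]]]]].
  rewrite rank_min ?muln0.
    by apply: nth_shift_steps0; rewrite sw (cardD1 p) pA; lia.
  by move=> x xA; apply/negP => /(min _ xA); rewrite l1.
apply: nth_shift_steps; case: i i0 ik lqp nx np => // i _ ik lqp nx np.
have nlp x : x \in A -> x < p ->
    ~~ linked (rcons (behead pi) (hat1 A)) i.+1 x p.
  by move=> xA xp; rewrite lS // np.
apply: (H p) => //; case: (posnP i) => [i0|i0].
  subst i; left; split=> //; rewrite (@rank_next _ _ q p) //.
    by rewrite mulnS; lia.
  move=> x xA; apply/negP => h; have /negP[] := nx _ xA h; exact: l1.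
right; exists i, q; rewrite i0 (ltnW ik) lS //; split; split=> //.
  by move=> x xA h; rewrite lS // nx.
lia.
Qed.

(** Otherwise the minimum of [B], the minimum of [C], a point of [B] and a
    point of [C] would follow each other in this order and cross. *)
Lemma separated_blocks n (A : {set 'I_n}) pi B C :
  is_chain A pi -> nc_on A pi -> 0 < size pi ->
  B \in head set0 pi -> C \in head set0 pi -> B != C -> set_min B <= set_min C ->
  separated pi B C.
Proof.
move=> cpi nc s0 BP CP BC le.
have hE : nth (hat1 setT) pi 0 = head set0 pi by case: pi s0 {cpi nc BP CP}.
have pP := nth_partition cpi s0; rewrite hE in pP.
have /and3P[_ tri P0] := pP.
have BA := subsetP (block_sub pP BP); have CA := subsetP (block_sub pP CP).
have dBC := trivIsetP tri _ _ BP CP BC.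
have lB x y X : X \in head set0 pi -> x \in X -> linked pi 1 x y = (y \in X).
  move=> XP xX; rewrite /linked hE; apply/exists_inP/idP => [[Y YP /andP[xY yY]]|yX].
    by rewrite -(def_pblock tri XP xX) (def_pblock tri YP xY).
  by exists X; rewrite ?xX.
split=> //.
  by move=> x y xB yC; rewrite (lB _ _ B) // (disjointFl dBC yC).
have B0 : B != set0 by apply: contraNneq P0 => <-.
have C0 : C != set0 by apply: contraNneq P0 => <-.
have [b bB mB] := set_min_mem B0; have [c cC mC] := set_min_mem C0.
move=> x y xB yC; rewrite mC => cx; rewrite ltnNge; apply/negP => xy.
have bc : b < c.
  rewrite ltn_neqAle -mB -mC le andbT mB mC; apply/eqP => /val_inj E.
  by rewrite -E (disjointFr dBC bB) in cC.
have xlty : x < y.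
  rewrite ltn_neqAle xy andbT; apply/eqP => /val_inj E.
  by rewrite -E (disjointFr dBC xB) in yC.
have := nc 1 b c x y isT (BA _ bB) (CA _ cC) (BA _ xB) (CA _ yC) bc cx xlty.
rewrite (lB _ _ B) // (lB _ _ C) // (lB _ _ B) // => /(_ xB yC) cB.
by rewrite (disjointFr dBC cB) in cC.
Qed.

Lemma nc_shift n (A : {set 'I_n}) pi : 0 < size pi ->
  nc_on A pi -> nc_on A (rcons (behead pi) (hat1 A)).
Proof.
move=> s0 nc i a b c d i0 aA bA cA dA ab bc cd.
rewrite !linked_shift -?size_eq0 -?lt0n //; exact: nc.
Qed.

Lemma nc_restrict n (A B : {set 'I_n}) pi : B \subset A ->
  nc_on A pi -> nc_on B [seq restrict B P | P <- pi].
Proof.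
move=> /subsetP BA nc i a b c d i0 aB bB cB dB ab bc cd.
rewrite !linked_restrict //; apply: nc => //; exact: BA.
Qed.

(** Follows the fuel of the recursion; [d] bounds the number of layers that
    are not yet reduced to singletons. *)
Lemma realizes_rec k n m d (A : {set 'I_n}) pi :
  is_chain A pi -> nc_on A pi -> size pi = k -> trivial_from d A pi ->
  enough_fuel m d A pi -> realizes k pi A (NCPtoDyck_rec k m A pi).
Proof.
elim: m d A pi => [|m IH] d A pi cpi nc szpi tr fu.
  have d0 : d = 0 by move: fu; rewrite /enough_fuel; case: eqP; lia.
  by move: tr; rewrite d0 trivial_from0 /= => tr; rewrite tr; apply: realizes_trivial.
rewrite /=; case: (boolP (all (pred1 (hat1 A)) pi)) => [|nt].
  exact: realizes_trivial.
case: d tr fu => [|d] tr fu; first by rewrite trivial_from0 (negbTE nt) in tr.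
have dk : d < k by case/andP: tr; rewrite szpi.
have pi_gt0 : 0 < size pi by rewrite szpi; case: (k) dk.
case: ifP => hd.
  apply: realizes_shift => //; first exact/eqP.
  apply: (IH d).
  - exact: is_chain_shift.
  - exact: nc_shift.
  - by rewrite size_rcons size_behead szpi prednK // (leq_ltn_trans _ dk).
  - exact: trivial_from_shift.
  - by move: fu; rewrite /enough_fuel hd; lia.
have pP := head_partition cpi nt; have /and3P[/eqP cov tri P0] := pP.
set P := head set0 pi in pP cov tri P0 hd *.
have BsP B : B \in blocks_by_min P -> B \in P by rewrite mem_blocks.
set mu := (fun B => _); rewrite /insert_blocks.
suff : realizes k pi (foldl (insert_block k mu) ([::], set0) (blocks_by_min P)).2
         (foldl (insert_block k mu) ([::], set0) (blocks_by_min P)).1.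
  suff -> : (foldl (insert_block k mu) ([::], set0) (blocks_by_min P)).2 = A by [].
  have snd Bs st : (foldl (insert_block k mu) st Bs).2 = st.2 :|: \bigcup_(B <- Bs) B.
    elim: Bs st => [|B Bs IHs] st /=; first by rewrite big_nil setU0.
    by rewrite IHs big_cons setUA.
  rewrite snd set0U -cov /cover (perm_big (enum P)) ?big_enum //=.
  exact: permEl (perm_sort _ _).
apply: (@realizes_foldl _ _ A) => [i x y i0 xA|||B C s1 s2 E Cs2|].
- exact: linked_le cpi xA _.
- exact: sub0set.
- move=> B /BsP BP; have BA := block_sub pP BP; split=> //.
  + by apply: contraNneq P0 => <-.
  + by split=> [|x y|x y]; rewrite ?inE // -setI_eq0 set0I.
  + apply: realizes_restrict; apply: (IH d.+1).
    * exact: is_chain_restrict cpi BA.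
    * exact: nc_restrict BA nc.
    * by rewrite size_map.
    * exact: trivial_from_restrict tr BA.
    * apply: (enough_fuel_block cpi nt BP).
      by move: fu; rewrite /enough_fuel hd addn0.
- have uB : uniq (blocks_by_min P) by rewrite sort_uniq enum_uniq.
  apply: (separated_blocks cpi nc) => //.
  + by apply: BsP; rewrite E mem_cat mem_head orbT.
  + by apply: BsP; rewrite E mem_cat in_cons Cs2 !orbT.
  + by move: uB; rewrite E cat_uniq /= => /and4P[_ _ + _]; apply: contraNneq => ->.
  + have tot : total (fun X Y : {set 'I_n} => set_min X <= set_min Y).
      by move=> X Y; apply: leq_total.
    have := sort_sorted tot (enum P); rewrite -/(blocks_by_min P) E.
    case/cat_sorted2 => _ /=.
    by move/(order_path_min (fun Y X Z => @leq_trans _ _ _))/allP/(_ C Cs2).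
- by split=> [|p y]; rewrite ?cards0 ?muln0 ?inE.
Qed.

(** * The path of a system of layers *)

(** A chain as relations on all natural numbers: layer [i] links [x] to [y] when
    [r i x y].  With the trivial layers 0 and [k+1], minima and predecessors
    need no case distinction, and the number of points only enters in
    [path_word]. *)
Record layered k (r : nat -> rel nat) : Prop := Layered {
  layer_refl : forall i x, r i x x;
  layer_sym : forall i x y, r i x y -> r i y x;
  layer_trans : forall i x y z, r i x y -> r i y z -> r i x z;
  layer_top : forall x y, r 0 x y;
  layer_bot : forall x y, r k.+1 x y -> x = y;
  layer_succ : forall i x y, r i.+1 x y -> r i x y;
  layer_nc : forall i a b c d, a < b -> b < c -> c < d ->
    r i a c -> r i b d -> r i a b }.

(** [i] is the last layer in which [p] is not a minimum, and [q] is the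
    predecessor of [p] in its block of that layer. *)
Definition opens k (r : nat -> rel nat) (p i q : nat) : Prop :=
  [/\ i <= k, q < p, r i q p, forall x, q < x < p -> ~~ r i x p
    & forall x, x < p -> ~~ r i.+1 x p].

Definition open_layer k (r : nat -> rel nat) p :=
  find (fun i => all (fun x => ~~ r i.+1 x p) (iota 0 p)) (iota 0 k).

(** The value [k.+1 * q + (k.+1 - i)] for [opens k r p i q], in the form
    [k.+1 * q.+1 - i]: the search yields 0 in place of [q.+1] when [p = 0], and
    then the value is 0 as it should be. *)
Definition up_step k (r : nat -> rel nat) p :=
  let i := open_layer k r p in
  k.+1 * (p - find (fun j => r i (p - j.+1) p) (iota 0 p)) - i.

Definition path_word k n (r : nat -> rel nat) : seq bool :=
  mkseq (fun y => y \in [seq up_step k r p | p <- iota 0 n]) (k.+1 * n).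

Lemma layer_le k r i j x y : layered k r -> i <= j -> r j x y -> r i x y.
Proof.
move=> lr; elim: j => [|j IH]; first by rewrite leqn0 => /eqP->.
rewrite leq_eqVlt => /orP[/eqP->//|]; rewrite ltnS => ij /(layer_succ lr).
exact: IH.
Qed.

Lemma opens_uniq k r p i q i' q' :
  layered k r -> opens k r p i q -> opens k r p i' q' -> i = i' /\ q = q'.
Proof.
move=> lr [_ qp rq nq np] [_ qp' rq' nq' np'].
have E : i = i'.
  case: (ltngtP i i') => // lt.
    by have /negP[] := np _ qp'; apply: (layer_le lr _ rq').
  by have /negP[] := np' _ qp; apply: (layer_le lr _ rq).
subst i'; split=> //; case: (ltngtP q q') => // lt.
  by have := nq q'; rewrite lt qp' rq' => /(_ isT).
by have := nq' q; rewrite lt qp rq => /(_ isT).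
Qed.

Lemma up_stepP k r p : layered k r -> 0 < p ->
  exists i q, opens k r p i q /\ up_step k r p = k.+1 * q + (k.+1 - i).
Proof.
move=> lr p0; rewrite /up_step; set i := open_layer k r p.
have ik : i <= k by rewrite -[X in _ <= X](size_iota 0) find_size.
have np x : x < p -> ~~ r i.+1 x p.
  move=> xp; case: (ltngtP i k) ik => // [ltk _|ek _]; last first.
    by rewrite ek; apply/negP => /(layer_bot lr) E; rewrite E ltnn in xp.
  have : has (fun i => all (fun x => ~~ r i.+1 x p) (iota 0 p)) (iota 0 k).
    by rewrite has_find size_iota.
  move/(nth_find 0); rewrite -/(open_layer k r p) -/i nth_iota // => /allP; apply.
  by rewrite mem_iota.
have hs : has (fun j => r i (p - j.+1) p) (iota 0 p).
  case: (posnP i) => [i0|i0].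
    by apply/hasP; exists 0; rewrite ?mem_iota // i0; apply: layer_top lr _ _.
  have := @before_find _ 0 (fun i => all (fun x => ~~ r i.+1 x p) (iota 0 p)) (iota 0 k) i.-1.
  rewrite -/(open_layer k r p) -/i => /(_ _); have -> : i.-1 < i by lia.
  move/(_ isT); rewrite nth_iota; last by lia.
  move/negbT; rewrite -has_predC => /hasP[x].
  rewrite mem_iota !add0n /= negbK prednK // => xp rx.
  apply/hasP; exists (p - x.+1); first by rewrite mem_iota; lia.
  by have -> : p - (p - x.+1).+1 = x by lia.
have := hs; rewrite has_find size_iota; set j := find _ _ => jp.
have rj : r i (p - j.+1) p.
  by have := nth_find 0 hs; rewrite -/j nth_iota.
exists i, (p - j.+1); split; last first.
  by rewrite -(subnSK jp) mulnS addnC addnBA // leqW.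
split=> //; first by lia.
move=> x /andP[h xp].
have := @before_find _ 0 (fun j => r i (p - j.+1) p) (iota 0 p) (p - x.+1).
rewrite -/j => /(_ _)/negbT; rewrite nth_iota ?add0n; last by lia.
by rewrite (_ : p - (p - _).+1 = x); [apply; lia | lia].
Qed.

Lemma up_stepE k r p i q : layered k r -> opens k r p i q ->
  up_step k r p = k.+1 * q + (k.+1 - i).
Proof.
move=> lr o; have [_ qp _ _ _] := o.
have [|i' [q' [o' ->]]] := up_stepP (p := p) lr; first by lia.
by have [-> ->] := opens_uniq lr o o'.
Qed.

Lemma up_step0 k r : up_step k r 0 = 0.
Proof. by rewrite /up_step sub0n muln0 sub0n. Qed.

Lemma step_code k q i q' i' : i <= k -> i' <= k ->
  k.+1 * q + (k.+1 - i) = k.+1 * q' + (k.+1 - i') -> q = q' /\ i = i'.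
Proof.
move=> ik ik' E.
have q_eq : q = q'.
  case: (ltngtP q q') => // lt.
    have : k.+1 * q.+1 <= k.+1 * q' by rewrite leq_mul2l lt orbT.
    by rewrite mulnS; lia.
  have : k.+1 * q'.+1 <= k.+1 * q by rewrite leq_mul2l lt orbT.
  by rewrite mulnS; lia.
by split=> //; subst q'; lia.
Qed.

(** The letter number determines [i] and [q], and [q] has only one successor
    in its block. *)
Lemma up_step_inj k r : layered k r -> injective (up_step k r).
Proof.
move=> lr; suff W p p' : up_step k r p = up_step k r p' -> p < p' -> False.
  by move=> p p' E; case: (ltngtP p p') => // lt; [case: (W p p')|case: (W p' p)].
move=> E lt; have [|i' [q' [o' E']]] := up_stepP (p := p') lr; first by lia.
move: E; rewrite E'; case: (posnP p) => [->|p0]; first by rewrite up_step0; case: o'; lia.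
have [i [q [o ->]]] := up_stepP lr p0.
case: o o' => ik qp rq _ _ [ik' qp' rq' nq' _] /(step_code ik ik')[eq ei]; subst.
have /negP[] : ~~ r i' p p' by apply: nq'; rewrite qp lt.
by apply: (layer_trans lr _ rq'); apply: (layer_sym lr).
Qed.

Lemma up_step_le k r p : layered k r -> up_step k r p <= k.+1 * p.
Proof.
move=> lr; case: (posnP p) => [->|p0]; first by rewrite up_step0.
have [i [q [[_ qp _ _ _] ->]]] := up_stepP lr p0.
have : k.+1 * q.+1 <= k.+1 * p by rewrite leq_mul2l qp orbT.
by rewrite mulnS; lia.
Qed.

Lemma up_step_lt k r n p : layered k r -> p < n -> up_step k r p < k.+1 * n.
Proof. by move=> lr pn; rewrite (leq_ltn_trans (up_step_le _ lr)) // ltn_mul2l. Qed.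

Lemma nth_word k n r y : y < k.+1 * n ->
  nth false (path_word k n r) y = (y \in [seq up_step k r p | p <- iota 0 n]).
Proof. by move=> yn; rewrite nth_mkseq. Qed.

Lemma nth_word_step k n r p : layered k r -> p < n ->
  nth false (path_word k n r) (up_step k r p).
Proof.
move=> lr pn; rewrite nth_word ?up_step_lt //; apply/mapP; exists p => //.
by rewrite mem_iota.
Qed.

Lemma count_take_word k n r z : layered k r -> z <= k.+1 * n ->
  count_mem true (take z (path_word k n r)) = count (fun p => up_step k r p < z) (iota 0 n).
Proof.
move=> lr zn; rewrite /path_word /mkseq -map_take take_iota (minn_idPl zn) count_map.
rewrite -(count_map (up_step k r) (fun y => y < z)) -!size_filter.
apply/perm_size/uniq_perm.
- by rewrite filter_uniq ?iota_uniq.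
- by rewrite filter_uniq // (map_inj_uniq (up_step_inj lr)) iota_uniq.
- move=> y; rewrite !mem_filter mem_iota add0n /= andbC.
  by case: (y < z); rewrite //= eqb_id.
Qed.

Lemma count_word k n r : layered k r -> count_mem true (path_word k n r) = n.
Proof.
move=> lr; rewrite -(take_size (path_word k n r)) size_mkseq count_take_word //.
rewrite -[RHS](size_iota 0); apply/eqP; rewrite -all_count; apply/allP => p.
by rewrite mem_iota => pn; apply: up_step_lt.
Qed.

(** Lets one inclusion between the up steps of two paths suffice. *)
Lemma eq_of_count (s t : seq bool) : size s = size t ->
  count_mem true s = count_mem true t ->
  (forall i, nth false s i -> nth false t i) -> s = t.
Proof.
elim: s t => [|a s IH] [|b t] //= [sz] ct H.
have Hs i : nth false s i -> nth false t i by apply: (H i.+1).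
have le : forall s t : seq bool, size s = size t ->
    (forall i, nth false s i -> nth false t i) -> count_mem true s <= count_mem true t.
  elim=> [|a' s' IH'] [|b' t'] //= [sz'] H'.
  by have := IH' _ sz' (fun i => H' i.+1); have := H' 0; case: a' {H'}; case: b' => //=; lia.
have := H 0; have := le _ _ sz Hs; move: ct; case: a {H}; case: b => //= ct l h.
- by congr cons; apply: IH => //; apply: addnI ct.
- by have := h isT.
- by move: l; rewrite -[count _ s]/(0 + _) ct add1n ltnn.
- by congr cons; apply: IH.
Qed.

Lemma word_unique k n r w : layered k r -> size w = k.+1 * n ->
  count_mem true w = n -> (forall p, p < n -> nth false w (up_step k r p)) ->
  w = path_word k n r.
Proof.
move=> lr sw cw H; apply/esym/eq_of_count; first by rewrite size_mkseq.
  by rewrite count_word.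
move=> y wy; have := wy; rewrite nth_word; last by have := nth_true wy; rewrite size_mkseq.
by case/mapP => p; rewrite mem_iota => pn ->; apply: H.
Qed.

Lemma eq_word k n (r r' : nat -> rel nat) :
  (forall i x y, x < n -> y < n -> r i x y = r' i x y) -> path_word k n r = path_word k n r'.
Proof.
move=> E; have Es p : p < n -> up_step k r p = up_step k r' p.
  move=> pn; rewrite /up_step.
  have -> : open_layer k r p = open_layer k r' p.
    apply: eq_find => i; apply: eq_in_all => x; rewrite mem_iota => xp.
    by rewrite E //; lia.
  rewrite (_ : find _ _ = find (fun j => r' (open_layer k r' p) (p - j.+1) p) (iota 0 p)) //.
  apply: eq_in_find => j; rewrite mem_iota => jp; apply: E => //; lia.
apply: eq_mkseq => y; congr (y \in _); apply/eq_in_map => p.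
by rewrite mem_iota => /Es.
Qed.

(** * Adding a point to a chain *)

(** Identifies [m] with [m-1] and closes the gap; a new point [m = 0] has no
    twin, and then only layer 0 is pulled back in this way. *)
Definition merge_down m x := x - (m <= x).

(** The new point [m] is a twin of [m-1] in the layers up to [i] and is isolated
    in the later ones. *)
Definition add_point m i (r : nat -> rel nat) : nat -> rel nat := fun j x y =>
  if (i < j) && ((x == m) || (y == m)) then x == y
  else r j (merge_down m x) (merge_down m y).

Definition del_point m (r : nat -> rel nat) : nat -> rel nat := fun j x y =>
  r j (bump m x) (bump m y).

Lemma layered_del k m r : layered k r -> layered k (del_point m r).
Proof.
move=> lr; split; rewrite /del_point.
- by move=> i x; apply: layer_refl lr _ _.
- by move=> i x y; apply: layer_sym lr _ _ _.
- by move=> i x y z; apply: layer_trans lr _ _ _ _.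
- by move=> x y; apply: layer_top lr _ _.
- by move=> x y /(layer_bot lr); rewrite /bump; lia.
- by move=> i x y; apply: layer_succ lr _ _ _.
- move=> i a b c d ab bc cd; apply: (layer_nc lr); rewrite /bump; lia.
Qed.

(** Up to layer [i] the new relation is the pull-back along a monotone map;
    after it the new point is isolated.  So crossings come from crossings. *)
Lemma layered_add k m i r : layered k r -> i <= k -> (m = 0 -> i = 0) ->
  layered k (add_point m i r).
Proof.
move=> lr ik m0; split; rewrite /add_point.
- by move=> j x; rewrite eqxx; case: ifP => // _; apply: layer_refl lr _ _.
- move=> j x y; rewrite [(y == m) || _]orbC [y == x]eq_sym; case: ifP => // _.
  exact: layer_sym lr _ _ _.
- move=> j x y z; case: (boolP (i < j)) => /= _; last exact: layer_trans lr _ _ _ _.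
  case: (eqVneq x m) => [->|xm] /=; first by move/eqP<-; rewrite eqxx.
  case: (eqVneq y m) => [->|ym] /=; first by rewrite (negbTE xm).
  case: ifP => [/eqP-> _|_]; first by rewrite (negbTE ym).
  exact: layer_trans lr _ _ _ _.
- by move=> x y; rewrite ltn0 /=; apply: layer_top lr _ _.
- move=> x y; rewrite ltnS ik /=; case: ifP => [_ /eqP//|/negbT].
  by rewrite negb_or => /andP[xm ym] /(layer_bot lr); rewrite /merge_down; lia.
- move=> j x y; case: (ltngtP i j) => ij.
  + rewrite ltnW //=; case: ifP => // _; exact: layer_succ lr _ _ _.
  + rewrite ifF; last by lia.
    exact: layer_succ lr _ _ _.
  + rewrite ij ltnSn /=; case: ifP => [_ /eqP->|_]; first exact: layer_refl lr _ _.
    exact: layer_succ lr _ _ _.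
- move=> j a b c d ab bc cd; case: (boolP (i < j)) => /= ij.
    case: ifP => [_ /eqP|/negbT ac]; first by lia.
    case: ifP => [_ /eqP|/negbT bd]; first by lia.
    rewrite ifF; last by lia.
    apply: (layer_nc lr); rewrite /merge_down; lia.
  case: (posnP m) => [/m0 i0 _ _|mp].
    by move: ij; rewrite i0 -eqn0Ngt => /eqP->; apply: layer_top lr _ _.
  have [Hab Hbc Hcd] : [/\ merge_down m a <= merge_down m b,
      merge_down m b <= merge_down m c & merge_down m c <= merge_down m d].
    by rewrite /merge_down; split; lia.
  have [->|{}Hab] : merge_down m a = merge_down m b \/ merge_down m a < merge_down m b by lia.
    by move=> _ _; apply: layer_refl lr _ _.
  have [->//|{}Hbc] : merge_down m b = merge_down m c \/ merge_down m b < merge_down m c by lia.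
  have [<-|{}Hcd] : merge_down m c = merge_down m d \/ merge_down m c < merge_down m d by lia.
    by move=> ac bc'; apply: (layer_trans lr ac); apply: (layer_sym lr).
  exact: (layer_nc lr).
Qed.

Lemma opens_add_new k m i r : layered k r -> i <= k -> 0 < m ->
  opens k (add_point m i r) m i m.-1.
Proof.
move=> lr ik m0; rewrite /opens /add_point ltnn /=; split=> //.
- by lia.
- have -> : merge_down m m.-1 = merge_down m m by rewrite /merge_down; lia.
  exact: layer_refl lr _ _.
- by move=> x; lia.
- by move=> x xm; rewrite ltnSn eqxx orbT /=; lia.
Qed.

(** The predecessor of an old point is the old one, except that [m] takes the
    place of its twin [m-1] where the two are linked. *)
Lemma opens_add_old k m i r p j q : layered k r -> i <= k -> (m = 0 -> i = 0) ->
  p != m -> opens k r (merge_down m p) j q ->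
  opens k (add_point m i r) p j
    (if (m <= q) || (m <= q.+1) && (j <= i) then q.+1 else q).
Proof.
move=> lr ik m0 pm; set p' := merge_down m p => -[jk qp rq nq np].
have Ep : p = bump m p' by rewrite /p' /merge_down /bump; lia.
set q' := (if _ then _ else _).
have qp' : q' < p by rewrite /q' Ep /bump; case: ifP; lia.
have eq' : merge_down m q' = q.
  by rewrite /q' /merge_down; case: ifP; lia.
have mono x : x < p -> x != m -> merge_down m x < p'.
  by rewrite /p' /merge_down; lia.
split=> //.
- rewrite /add_point ifF -?/p' ?eq' // (negbTE pm) orbF; apply/negbTE.
  by rewrite negb_and -leqNgt /q'; case: ifP; lia.
- move=> x /andP[qx xp]; rewrite /add_point (negbTE pm) orbF.
  case: ifP => [/andP[_ /eqP->]|/negbT]; first by rewrite eq_sym.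
  rewrite negb_and -leqNgt => H; apply: nq; rewrite -/p'.
  move: qx xp H; rewrite /q' Ep /bump /merge_down; case: ifP; lia.
- move=> x xp; rewrite /add_point (negbTE pm) orbF.
  case: ifP => [/andP[_ /eqP->]|/negbT]; first by rewrite eq_sym.
  rewrite negb_and -leqNgt => H; apply: np; rewrite -/p'.
  by move: xp H; rewrite Ep /bump /merge_down; lia.
Qed.

Lemma up_step_add_new k m i r : layered k r -> i <= k -> (m = 0 -> i = 0) ->
  up_step k (add_point m i r) m = k.+1 * m - i.
Proof.
move=> lr ik m0; case: (posnP m) => [E|mp]; first by rewrite E up_step0 muln0.
rewrite (up_stepE (layered_add lr ik m0) (opens_add_new lr ik mp)).
by rewrite -[in RHS](prednK mp) mulnS addnC addnBAC // leqW.
Qed.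

(** Among the points with predecessor [m-1], exactly those in layers up to [i]
    have their up step at or after the place of insertion, and their
    predecessor becomes [m]; so all later up steps move by [k+1]. *)
Lemma up_step_add_old k m i r p : layered k r -> i <= k -> (m = 0 -> i = 0) ->
  p != m -> up_step k (add_point m i r) p =
  if up_step k r (merge_down m p) < k.+1 * m - i then up_step k r (merge_down m p)
  else up_step k r (merge_down m p) + k.+1.
Proof.
move=> lr ik m0 pm; set p' := merge_down m p.
have la := layered_add lr ik m0.
case: (posnP p') => [E|p0].
  rewrite E up_step0; case: (posnP p) => [Ep|pp].
    rewrite Ep up_step0 ifT //.
    have mp : 0 < m by lia.
    by rewrite -(prednK mp) mulnS; lia.
  have [p1 mE] : p = 1 /\ m = 0 by move: E; rewrite /p' /merge_down; lia.
  have i0 := m0 mE; rewrite mE muln0 /= p1 i0.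
  rewrite (@up_stepE k (add_point 0 0 r) 1 0 0) //; first by rewrite muln0; lia.
    by rewrite mE i0 in la.
  split=> //; first by apply: layer_top lr _ _.
    by case.
  by case=> //.
have [j [q [o ->]]] := up_stepP lr p0; have := opens_add_old lr ik m0 pm o.
move/(up_stepE la)->; have [jk _ _ _ _] := o.
case: (ltngtP m q.+1) => [mq|mq|mq].
- rewrite ltnS in mq; rewrite mq /= ifF; first by rewrite mulnS; lia.
  have : k.+1 * m <= k.+1 * q by rewrite leq_mul2l mq orbT.
  by lia.
- rewrite ifF; last by lia.
  rewrite ifT //.
  have : k.+1 * q.+2 <= k.+1 * m by rewrite leq_mul2l mq orbT.
  by rewrite !mulnS; lia.
- rewrite mq ltnn /= mulnS; case: (leqP j i) => ji.
    by rewrite ifF; [lia|apply/negbTE; rewrite -leqNgt; lia].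
  by rewrite ifT //; lia.
Qed.

Lemma word_add k n m i r : layered k r -> i <= k -> (m = 0 -> i = 0) -> m <= n ->
  let w := path_word k n r in let a := k.+1 * m - i in
  path_word k n.+1 (add_point m i r) =
    take a w ++ (stepU :: nseq k stepR) ++ drop a w.
Proof.
move=> lr ik m0 mn w a.
have aw : a <= size w.
  by rewrite size_mkseq (leq_trans (leq_subr _ _)) // leq_mul2l mn orbT.
apply/esym/word_unique; first exact: layered_add.
- rewrite !size_cat size_takel // size_drop /= size_nseq size_mkseq mulnS.
  by move: aw; rewrite size_mkseq; lia.
- rewrite !count_cat addnCA -count_cat cat_take_drop count_word //=.
  by rewrite count_nseq /= mul0n addn0 add1n.
move=> p pn; case: (eqVneq p m) => [->|pm].
  by rewrite up_step_add_new // -/a -[X in nth _ _ X]addn0 nth_insert_in.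
rewrite up_step_add_old // -/a.
have H : nth false w (up_step k r (merge_down m p)).
  by apply: nth_word_step => //; move: pm pn; rewrite /merge_down; lia.
case: ltnP => h; first by rewrite nth_insert_lt.
have -> : k.+1 = size (true :: nseq k false) by rewrite /= size_nseq.
by rewrite nth_insert_ge.
Qed.

(** * Chains and paths determine each other *)

(** The point [p] with the last up step is removable: it is a twin of [p-1] up to
    some layer [i] and isolated afterwards, because any other arrangement
    produces a point with a later up step. *)
Lemma last_step k n r p : layered k r -> p < n.+1 ->
  (forall x, x < n.+1 -> up_step k r x <= up_step k r p) ->
  exists2 i, [/\ i <= k, p = 0 -> i = 0 & up_step k r p = k.+1 * p - i]
    & forall j x y, x < n.+1 -> y < n.+1 ->
        r j x y = add_point p i (del_point p r) j x y.
Proof.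
move=> lr pn max; case: (posnP p) => [p0|p0].
  subst p; case: n pn max => [|n] _ max; last first.
    have [i [q [[ik _ _ _ _] E]]] := @up_stepP k r 1 lr isT.
    by have := max 1 isT; rewrite up_step0 E; lia.
  exists 0; first by rewrite up_step0 muln0.
  move=> j [|x] [|y] // _ _; rewrite /add_point eqxx andbT.
  by rewrite (layer_refl lr); case: ifP => // _; rewrite (layer_refl (layered_del 0 lr)).
have [i [q [o E]]] := up_stepP lr p0; have [ik qp rq nq np] := o.
have le_gt x j a : x < n.+1 -> opens k r x j a -> k.+1 * a + (k.+1 - j) <= k.+1 * q + (k.+1 - i).
  by move=> xn ox; have := max _ xn; rewrite E (up_stepE lr ox).
(* Otherwise the up step of the point [q+1] would come after the one of [p]:
   its last layer is before [i], and its predecessor there is [q]. *)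
have q_eq : q = p.-1.
  apply/eqP/negPn/negP => ne; have xp : q.+1 < p by lia.
  have [j [a [ox _]]] := @up_stepP k r q.+1 lr isT.
  have := le_gt _ _ _ (ltn_trans xp pn) ox; case: ox => jk ax ra na nb le.
  have aq : a <= q by [].
  have nqp : ~~ r i q.+1 p by apply: nq; rewrite ltnSn.
  have rqp j' : j' <= i -> r j' q p by move=> ?; apply: (layer_le lr _ rq).
  case: (leqP i j) => ij.
    have rax := layer_le lr ij ra.
    case: (ltngtP a q) aq => // [aq|aq] _.
      have raq := layer_nc lr aq (ltnSn q) xp rax rq.
      have /negP[] := nqp; apply: (layer_trans lr _ rq).
      by apply: (layer_trans lr _ raq); apply: (layer_sym lr).
    have /negP[] := nqp; apply: (layer_trans lr _ rq); apply: (layer_sym lr).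
    by subst a.
  case: (ltngtP a q) aq => // [aq|aq] _; last by subst a; move: le; lia.
  have raq := layer_nc lr aq (ltnSn q) xp ra (rqp _ (ltnW ij)).
  have /negP[] : ~~ r j q q.+1 by apply: na; rewrite aq /=.
  apply: (layer_trans lr _ ra); apply: (layer_sym lr raq).
(* A point linked to [p] in a later layer would come after [p] and have its
   predecessor at or after [p]. *)
have sing j x : i < j -> x < n.+1 -> x != p -> ~~ r j x p.
  move=> ij xn; rewrite neq_ltn => /orP[xp|px]; apply/negP => rxp.
    by have /negP[] := np _ xp; apply: (layer_le lr ij rxp).
  have [|j' [a [ox _]]] := @up_stepP k r x lr; first by lia.
  have := le_gt _ _ _ xn ox; case: ox => jk ax ra na nb le.
  have rpx : r j p x by apply: (layer_sym lr).
  have jj : j <= j'.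
    rewrite leqNgt; apply/negP => jj; have /negP[] := nb _ px.
    exact: (layer_le lr jj rpx).
  have pa : p <= a.
    rewrite leqNgt; apply/negP => ap; have /negP[] := np _ ap.
    apply: (layer_le lr ij); apply: (layer_trans lr _ rxp).
    exact: (layer_le lr jj ra).
  have : k.+1 * q.+1 <= k.+1 * a by rewrite leq_mul2l; apply/orP; right; lia.
  by rewrite mulnS; lia.
exists i.
  split=> //; first by lia.
  by rewrite E q_eq -[in RHS](prednK p0) mulnS addnC addnBAC // leqW.
have bumpK x : x != p -> bump p (merge_down p x) = x.
  by rewrite /bump /merge_down; lia.
have bumpp : bump p (merge_down p p) = q by rewrite /bump /merge_down; lia.
move=> j x y xn yn; rewrite /add_point /del_point; case: (ltnP i j) => ij /=.
  case: (eqVneq x p) => [->|xp] /=.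
    case: (eqVneq p y) => [->|py]; first exact: (layer_refl lr).
    apply/negbTE; apply: contra (sing j y ij yn _); last by rewrite eq_sym.
    exact: (layer_sym lr).
  case: (eqVneq y p) => [->|yp] /=; last by rewrite !bumpK.
  by rewrite (negbTE xp); apply/negbTE/sing.
have near z : r j z (bump p (merge_down p z)).
  case: (eqVneq z p) => [->|zp]; last by rewrite bumpK // (layer_refl lr).
  by rewrite bumpp; apply: (layer_sym lr); apply: (layer_le lr ij rq).
apply/idP/idP => H.
  apply: (layer_trans lr _ (near y)); apply: (layer_trans lr _ H).
  by apply: (layer_sym lr).
apply: (layer_trans lr (near x)); apply: (layer_trans lr H).
by apply: (layer_sym lr).
Qed.

Lemma point_code k m i m' i' : i <= k -> (m = 0 -> i = 0) ->
  i' <= k -> (m' = 0 -> i' = 0) -> k.+1 * m - i = k.+1 * m' - i' -> m = m' /\ i = i'.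
Proof.
move=> ik m0 ik' m0'.
have conv a j : j <= k -> (a = 0 -> j = 0) -> k.+1 * a - j + j = k.+1 * a.
  by move=> jk a0; apply: subnK; case: a a0 => [->//|a] _; rewrite mulnS; lia.
move=> E; have := conv _ _ ik m0; have := conv _ _ ik' m0'; rewrite E => H1 H2.
have em : m = m'.
  case: (ltngtP m m') => // lt.
    have : k.+1 * m.+1 <= k.+1 * m' by rewrite leq_mul2l lt orbT.
    by rewrite mulnS; lia.
  have : k.+1 * m'.+1 <= k.+1 * m by rewrite leq_mul2l lt orbT.
  by rewrite mulnS; lia.
by split=> //; subst m'; lia.
Qed.

Lemma last_step_exists k n r :
  exists2 p, p < n.+1 & forall x, x < n.+1 -> up_step k r x <= up_step k r p.
Proof.
have [i0 _ H] := @arg_maxnP _ (@ord0 n) xpredT (fun p : 'I_n.+1 => up_step k r p) isT.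
by exists i0 => // x xn; apply: (H (Ordinal xn)).
Qed.

(** The last up step determines the point it comes from and its layer, hence
    also where to delete [U R^k]; the rest is induction. *)
Lemma word_inj k n r r' : layered k r -> layered k r' -> path_word k n r = path_word k n r' ->
  forall j x y, x < n -> y < n -> r j x y = r' j x y.
Proof.
elim: n r r' => // n IH r r' lr lr' E.
have transfer s s' x : layered k s -> layered k s' ->
    path_word k n.+1 s = path_word k n.+1 s' -> x < n.+1 ->
    exists2 y, y < n.+1 & up_step k s x = up_step k s' y.
  move=> ls ls' Es xn; have := nth_word_step ls xn.
  rewrite Es nth_word ?up_step_lt // => /mapP[y].
  by rewrite mem_iota => yn ->; exists y.
have [p pn max] := last_step_exists k n r.
have [p' pn' Epp'] := transfer r r' p lr lr' E pn.
have max' x : x < n.+1 -> up_step k r' x <= up_step k r' p'.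
  move=> xn; have [y yn ->] := transfer r' r x lr' lr (esym E) xn.
  by rewrite -Epp' max.
have [i [ik p0 Ep] Hr] := last_step lr pn max.
have [i' [ik' p0' Ep'] Hr'] := last_step lr' pn' max'.
have [epp eii] : p = p' /\ i = i'.
  by apply: (point_code ik p0 ik' p0'); rewrite -Ep -Ep'.
subst p' i'; have ld := layered_del p lr; have ld' := layered_del p lr'.
have : path_word k n (del_point p r) = path_word k n (del_point p r').
  have aw s : k.+1 * p - i <= size (path_word k n s).
    rewrite size_mkseq; apply: leq_trans (leq_subr _ _) _.
    by rewrite leq_mul2l -ltnS pn orbT.
  move: E; rewrite (eq_word k Hr) (eq_word k Hr') !word_add //.
  move/eqP; rewrite eqseq_cat ?size_takel //.
  rewrite eqseq_cat // => /andP[/eqP t /andP[_ /eqP d]].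
  by rewrite -(cat_take_drop (k.+1 * p - i) (path_word k n (del_point p r))) t d cat_take_drop.
move=> /(IH _ _ ld ld') Hd j x y xn yn.
rewrite Hr // Hr' // /add_point; case: (ltnP i j) => ij /=.
  by case: ifP => // /negbT; rewrite negb_or => /andP[xp yp]; apply: Hd;
     rewrite /merge_down; lia.
case: (posnP p) => [p00|p_gt0]; last by apply: Hd; rewrite /merge_down; lia.
have j0 : j = 0 by move: ij; rewrite p0 // leqn0 => /eqP.
by rewrite j0 (layer_top ld) (layer_top ld').
Qed.

Lemma split_last_up (w : seq bool) : true \in w ->
  exists s j, w = s ++ true :: nseq j false.
Proof.
elim/last_ind: w => // w [] IH; first by exists w, 0; rewrite cats1.
rewrite mem_rcons inE /= => /IH[s [j ->]]; exists s, j.+1.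
by rewrite -cats1 -catA cat_cons -[[:: false]]/(nseq 1 false) -nseqD addn1.
Qed.

(** The height after the last U is at least [k], so k right steps follow it.
    Removing this U and k of the right steps leaves a path, and the point to be
    added is read off the number [y] of the removed letter by division. *)
Lemma word_surj k n w : is_kdyck k n w ->
  exists2 r, layered k r & path_word k n r = w.
Proof.
elim: n w => [|n IH] w /and3P[/eqP sw /eqP cw /above_lineP aw].
  exists (fun j x y => (j == 0) || (x == y)).
    split=> //; first by move=> *; rewrite eqxx orbT.
    - by move=> j x y; rewrite [x == y]eq_sym.
    - by move=> j x y z; case: (j == 0) => //= /eqP->.
    - by move=> x y /= /eqP.
    - by move=> j x y /= /eqP->; rewrite eqxx orbT.
    - by move=> j a b c d ab bc cd; case: (j == 0) => //= /eqP E; lia.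
  by rewrite (size0nil (s := w)) ?sw ?muln0 // /path_word muln0.
have [|s [j wE]] := @split_last_up w; first by rewrite -has_pred1 has_count cw.
have cs : count_mem true s = n.
  by move: cw; rewrite wE count_cat /= count_nseq /= mul0n addn0 addn1 => -[].
have cf := count_bool w; rewrite cw sw in cf.
have cfw : count_mem false w = k * n.+1 by move: cf; rewrite mulSn; lia.
have cfs : count_mem false s <= k * n.
  by have := aw (size s); rewrite wE take_size_cat // cs.
have jE : count_mem false s + j = k * n.+1.
  by rewrite -cfw wE count_cat /= count_nseq /= mul1n add0n.
have kj : k <= j by move: jE; rewrite mulnS; lia.
have [] := IH (s ++ nseq (j - k) false).
  have cj : count_mem false s + (j - k) = k * n by move: jE; rewrite mulnS; lia.
  apply/and3P; split.
  - by rewrite size_cat size_nseq -(count_bool s) cs mulSn; apply/eqP; lia.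
  - by rewrite count_cat cs count_nseq /= mul0n addn0.
  apply/above_lineP => i; rewrite take_cat; case: ltnP => h.
    by have := aw i; rewrite wE take_cat h.
  rewrite !count_cat cs mulnDr; apply: leq_trans (leq_addr _ _).
  rewrite -cj leq_add2l; apply: leq_trans (count_size _ _) _.
  by rewrite size_take_min size_nseq geq_minr.
move=> r lr wr; set y := size s.
have yn : y <= k.+1 * n by rewrite /y -(count_bool s) cs mulSn addnC leq_add2l.
(* [m] is the quotient of [y] by [k.+1] rounded up, so that [i <= k]. *)
set m := (y + k) %/ k.+1; set i := k.+1 * m - y.
have hm := divn_eq (y + k) k.+1; have hlt := ltn_pmod (y + k) (ltn0Sn k).
rewrite -/m in hm.
have ik : i <= k by rewrite /i mulnC; lia.
have yE : k.+1 * m - i = y by rewrite /i subKn // mulnC; lia.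
have m0 : m = 0 -> i = 0 by move=> mz; rewrite /i mz muln0.
have mn : m <= n.
  rewrite -ltnS /m ltn_divLR // mulSn [n * _]mulnC; lia.
exists (add_point m i r); first exact: layered_add.
rewrite word_add // yE wr take_size_cat // drop_size_cat // wE.
by rewrite cat_cons -nseqD subnKC.
Qed.

(** * Promotion as a rewriting of words *)

Lemma swap_letters_cat s (a b : bool) t :
  swap_letters (size s).+1 (s ++ a :: b :: t) = s ++ b :: a :: t.
Proof.
have sz : size (s ++ a :: b :: t) = size (s ++ b :: a :: t) by rewrite !size_cat.
apply: (@eq_from_nth _ false); first by rewrite size_map size_iota sz.
move=> i; rewrite size_map size_iota => ilt.
rewrite (nth_map 0) ?size_iota // nth_iota // add1n /letter !eqSS.
case: (ltngtP i (size s)) => h; last 1 first.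
- by rewrite h /= !nth_cat !ltnn subnn ltnNge leqnSn subSnn.
- by rewrite ltn_eqF ?ltnS 1?ltnW // !nth_cat h.
case: (ltngtP i (size s).+1) => h'; first by lia.
  by rewrite /= !nth_cat !ltnNge (ltnW h) /=; case E: (i - size s) => [|[|j]] //; lia.
by rewrite h' /= !nth_cat ltnn subnn ltnNge leqnSn subSnn.
Qed.

Lemma above_line_prefix k s t : above_line k (s ++ t) -> above_line k s.
Proof.
move/above_lineP=> H; apply/above_lineP => i; have := H (minn i (size s)).
by rewrite take_min takel_cat // take_size.
Qed.

(** Only the prefix that ends between the two letters changes its height. *)
Lemma is_kdyck_swap k n s (a b : bool) t :
  is_kdyck k n (s ++ a :: b :: t) -> above_line k (s ++ [:: b]) ->
  is_kdyck k n (s ++ b :: a :: t).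
Proof.
case/and3P=> /eqP sz /eqP c /above_lineP A /above_lineP B.
have cE x t' : count_mem x (s ++ b :: a :: t') = count_mem x (s ++ a :: b :: t').
  by rewrite !count_cat /= [X in _ + X]addnCA.
apply/and3P; split; first by rewrite -sz !size_cat.
  by rewrite cE c.
apply/above_lineP => i; case: (leqP i (size s).+1) => h.
  have -> : s ++ b :: a :: t = (s ++ [:: b]) ++ a :: t by rewrite -catA.
  by rewrite takel_cat ?size_cat ?addn1.
have := A i; rewrite !take_cat !ltnNge (ltnW (ltnW h)) /=.
case E: (i - size s) => [|[|j]] /=; try by lia.
by rewrite !cE.
Qed.

Lemma toggle_cat k n (p : kdyck k n) s (a b : bool) t :
  dyck_word p = s ++ a :: b :: t ->
  dyck_word (toggle (size s).+1 p) =
    if is_kdyck k n (s ++ b :: a :: t) then s ++ b :: a :: t else s ++ a :: b :: t.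
Proof.
move=> E; rewrite -[LHS]/(val _) /toggle val_insubd E swap_letters_cat.
by case: ifP => //; rewrite -[val p]/(dyck_word p) E.
Qed.

(** A U moves to the right as long as the letters before it, without this U,
    stay above the line. *)
Lemma toggles_up k n (p : kdyck k n) s u t :
  dyck_word p = s ++ true :: u ++ t -> above_line k (s ++ u) ->
  dyck_word (foldl (fun q i => toggle i q) p (iota (size s).+1 (size u)))
    = s ++ u ++ true :: t.
Proof.
elim: u s p => [|c u IH] s p E A //=.
have := IH (rcons s c) (toggle (size s).+1 p).
rewrite size_rcons -!cats1 -!catA /= => -> //.
rewrite (toggle_cat E); case: ifP => //; case: c A {E} (E) => A E //.
move/negP; case; apply: is_kdyck_swap; first by rewrite -E; apply: dyck_wordP.
by apply: (@above_line_prefix _ _ u); rewrite -catA.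
Qed.

(** Moving an R to the right only raises the path, so no swap is refused. *)
Lemma toggles_right k n (p : kdyck k n) s u :
  dyck_word p = s ++ false :: u ->
  dyck_word (foldl (fun q i => toggle i q) p (iota (size s).+1 (size u)))
    = s ++ u ++ [:: false].
Proof.
elim: u s p => [|c u IH] s p E //=.
have := IH (rcons s c) (toggle (size s).+1 p).
rewrite size_rcons -!cats1 -!catA /= => -> //.
rewrite (toggle_cat E); case: ifP => //; case: c {E} (E) => E //.
have dp : is_kdyck k n (s ++ [:: false, true & u]) by rewrite -E; apply: dyck_wordP.
move/negP; case; apply: is_kdyck_swap => //.
have /and3P[_ _ /above_line_prefix/above_lineP A] := dp.
apply/above_lineP => i; rewrite take_cat; case: ltnP => _; first exact: A.
have := A (size s); rewrite take_size.
by case: (i - size s) => [|j] /=; rewrite ?cats0 // !count_cat /= mulnDr; lia.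
Qed.

Lemma promotion_word k n (p : kdyck k n) v1 v2 :
  dyck_word p = true :: v1 ++ false :: v2 ->
  above_line k v1 -> ~~ above_line k (v1 ++ [:: false]) ->
  dyck_word (promotion p) = v1 ++ true :: v2 ++ [:: false].
Proof.
move=> E A nA; rewrite /promotion.
have -> : (k.+1 * n).-1 = size v1 + (1 + size v2).
  have /and3P[/eqP <- _ _] := dyck_wordP p.
  by rewrite -[X in size X]/(dyck_word p) E /= size_cat /=; lia.
rewrite !iotaD !foldl_cat /=.
set q := foldl _ p _.
have Eq : dyck_word q = v1 ++ true :: false :: v2.
  exact: (@toggles_up _ _ p [::] v1 (false :: v2)).
(* This swap would complete the prefix that falls below the line, so it is
   refused, and from here on the letter that travels is the R. *)
have Et : dyck_word (toggle (1 + size v1) q) = (v1 ++ [:: true]) ++ false :: v2.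
  rewrite (toggle_cat Eq) -catA /= ifF //; apply/negbTE; apply: contra nA.
  case/and3P=> _ _ H; apply: (@above_line_prefix _ _ (true :: v2)).
  by rewrite -catA.
have := toggles_right Et; rewrite size_cat -catA /= => <-.
by congr (dyck_word (foldl _ _ (iota _ _))); lia.
Qed.

(** * The lifted chain *)

Lemma up_step_min k r q : layered k r -> (forall x, x < q -> ~~ r 1 x q) ->
  up_step k r q = k.+1 * q.
Proof.
move=> lr H; case: (posnP q) => [->|q0]; first by rewrite up_step0 muln0.
rewrite (@up_stepE k r q 0 q.-1) //; first by rewrite -[in RHS](prednK q0) mulnS; lia.
by split=> //; [lia|apply: layer_top lr _ _|move=> x; lia].
Qed.

(** For [x < y] this is the Kreweras complement of [s]: no block of [s] meets
    both the interval from [x+1] to [y] and its complement. *)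
Definition unsplit_by n (s : rel nat) x y :=
  forall a b, a < n -> b < n -> s a b -> (x < a <= y) = (x < b <= y).

(** Layer [j+1] of the lifted chain is the Kreweras complement of layer [k] met
    with layer [j]; for [j = 0] it is the complement itself. *)
Definition lifted k n (r r' : nat -> rel nat) :=
  forall j x y, j < k -> x < y -> y < n ->
    (r' j.+1 x y <-> unsplit_by n (r k) x y /\ r j x y).

Lemma unsplit_by_sym n (s : rel nat) x y : (forall a b, s a b -> s b a) ->
  (forall a b, a < n -> b < n -> s a b -> x < a <= y -> x < b <= y) ->
  unsplit_by n s x y.
Proof.
move=> sym H a b an bn sab; apply/idP/idP; first exact: H.
by apply: H => //; apply: sym.
Qed.

(** Let [q] be the predecessor of [p] in layer [i].  For [i = k] no block of the
    Kreweras complement links [q] to a smaller point, as it would separate [q]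
    from [p].  For [i < k] let [p'] be the maximum of the block of [p] in layer
    [k]: non-crossing blocks of layer [k] stay inside or outside the interval
    from [q+1] to [p'], while an interval starting at [p] or later and ending
    in [p'] separates [p] from [p'].  So [q] precedes [p'] in layer [i+1] of
    the lifted chain. *)
Lemma lift_step k n (r r' : nat -> rel nat) p :
  0 < k -> layered k r -> layered k r' -> lifted k n r r' ->
  0 < p -> p < n ->
  exists2 p', p' < n & up_step k r' p' = (up_step k r p).-1.
Proof.
move=> k0 lr lr' L p0 pn; have [i [q [o ->]]] := up_stepP lr p0.
case: o => ik qp rq nq np; case: (ltngtP i k) ik => // [{}ik|ik] _; last first.
  subst i; exists q; first exact: ltn_trans pn.
  rewrite up_step_min // ?subSnn ?addn1 // => x xq; apply/negP.
  case/(L 0 x q k0 xq (ltn_trans qp pn)) => /(_ q p (ltn_trans qp pn) pn rq) + _.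
  by rewrite xq leqnn [p <= q]leqNgt qp andbF.
(* [p'] is the maximum of the block of [p] in layer [k]. *)
have [p' /andP[pn' rpp'] max] : exists2 p', (p' < n) && r k p p' &
    forall x, x < n -> r k p x -> x <= p'.
  have ex : exists x, (x < n) && r k p x by exists p; rewrite pn (layer_refl lr).
  have ub x : (x < n) && r k p x -> x <= n by case/andP=> /ltnW.
  case: (ex_maxnP ex ub) => m Hm mx; exists m => // x xn rx.
  by apply: mx; rewrite xn.
have rk j x y : j <= k -> r k x y -> r j x y by apply: (layer_le lr).
have sym j x y : r j x y -> r j y x by apply: (layer_sym lr).
have tr j x y z : r j x y -> r j y z -> r j x z by apply: (layer_trans lr).
have npk x : x < p -> r k x p -> False.
  by move=> xp /(rk i.+1 _ _ ik) rx; have /negP[] := np _ xp.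
have pp' : p <= p' by apply: max => //; apply: (layer_refl lr).
(* A block of layer [k] that leaves the interval from [q+1] to [p'] crosses
   the block of [p] in layer [k] or the link from [q] to [p] in layer [i]. *)
have kq : unsplit_by n (r k) q p'.
  apply: unsplit_by_sym => [a b|a b an bn rab /andP[qa ap']]; first exact: sym.
  case: (leqP p a) => [pa|ap].
    have rpb : r k p b -> q < b <= p'.
      move=> rpb; rewrite max // andbT; apply: leq_trans qp _.
      by rewrite leqNgt; apply/negP => bp; apply: (npk _ bp); apply: sym.
    case: (ltngtP p a) pa => // [pa|pe] _; last by apply: rpb; rewrite pe.
    case: (ltngtP a p') ap' => // [ap'|ae] _; last first.
      by apply: rpb; apply: (tr _ _ _ _ rpp'); rewrite -ae.
    case: (leqP b p') => [bp'|p'b]; last first.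
      have rpa := layer_nc lr pa ap' p'b rpp' rab.
      by have := max _ bn (tr _ _ _ _ rpa rab); rewrite leqNgt p'b.
    case: (ltnP q b) => //= bq; exfalso; have bp : b < p := leq_ltn_trans bq qp.
    exact: (npk _ bp (layer_nc lr bp pa ap' (sym _ _ _ rab) rpp')).
  have nap : ~ r i a p by apply/negP; apply: nq; rewrite qa.
  have rabi := rk i _ _ (ltnW ik) rab.
  case: (leqP b p') => [bp'|p'b]; last first.
    case: nap; apply: (tr _ _ q) => //; apply: sym.
    exact: (layer_nc lr qa ap (leq_ltn_trans pp' p'b) rq rabi).
  case: (ltnP q b) => //= bq; exfalso; apply: nap.
  case: (ltngtP b q) bq => // [bq|be] _; last first.
    by apply: (tr _ _ q) => //; rewrite -be.
  apply: (tr _ _ b) => //; apply: (tr _ _ q) => //.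
  exact: (layer_nc lr bq qa ap (sym _ _ _ rabi) rq).
have qp' : q < p' := leq_trans qp pp'.
exists p' => //; rewrite (@up_stepE k r' p' i.+1 q) //; first by lia.
(* The points [p] and [p'] are linked in layer [k], and only [p'] is in the
   interval from [x+1] to [p']. *)
have nk x : p <= x -> x < p' -> ~ unsplit_by n (r k) x p'.
  move=> px xp' /(_ p' p pn' pn (sym _ _ _ rpp')).
  by rewrite xp' leqnn [x < p]ltnNge px.
split=> //.
- apply/(L i q p') => //; split=> //; apply: (tr _ _ p) => //.
  exact: rk (ltnW ik) rpp'.
- move=> x /andP[qx xp']; apply/negP => /(L i x p' ik xp' pn')[kx rx].
  case: (ltnP x p) => xp; last exact: (nk x).
  have /negP[] : ~~ r i x p by apply: nq; rewrite qx.
  by apply: (tr _ _ p') => //; apply/sym/rk/rpp'/ltnW.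
- move=> x xp'; apply/negP => rx.
  case: (ltngtP i.+1 k) ik => // [ik|ik] _; last first.
    by move: rx xp'; rewrite ik => /(layer_bot lr') ->; rewrite ltnn.
  have [kx {}rx] := (L i.+1 x p' ik xp' pn').1 rx.
  case: (ltnP x p) => xp; last exact: (nk x).
  have /negP[] := np _ xp; apply: (tr _ _ p') => //.
  exact/sym/rk/rpp'/ltnW.
Qed.

Definition last_of_zero k n (r : nat -> rel nat) M :=
  [/\ M < n, r k 0 M & forall x, x < n -> r k 0 x -> x <= M].

(** A smaller point in the same block of the Kreweras complement would separate
    0 from [M]. *)
Lemma lift_step_zero k n r r' M : 0 < k -> layered k r -> layered k r' -> lifted k n r r' ->
  last_of_zero k n r M -> up_step k r' M = k.+1 * M.
Proof.
move=> k0 lr lr' L [Mn rM _]; apply: up_step_min => // x xM; apply/negP.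
case/(L 0 x M k0 xM Mn) => /(_ 0 M (leq_ltn_trans (leq0n M) Mn) Mn rM) + _.
by rewrite ltn0 xM leqnn.
Qed.

(** The blocks of 0 and of [p] in the layer of [p] do not cross, so the
    predecessor of [p] is at least [M]; and if it is [M] then the layer is not
    [k], since [M] is a maximum there. *)
Lemma up_step_gt k n r M p : layered k r -> last_of_zero k n r M -> M < p -> p < n ->
  k.+1 * M + 1 < up_step k r p.
Proof.
move=> lr [Mn rM max] Mp pn; have [|i [q [[ik qp rq nq np] ->]]] := @up_stepP k r p lr.
  by lia.
have rMi : r i 0 M by apply: (layer_le lr ik rM).
have Mq : M <= q.
  rewrite leqNgt; apply/negP => qM.
  have /negP[] : ~~ r i M p by apply: nq; rewrite qM.
  case: (posnP q) => [q0|q0].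
    by apply: (layer_trans lr (layer_sym lr rMi)); rewrite -q0.
  have r0q := layer_nc lr q0 qM Mp rMi rq.
  apply: (layer_trans lr (layer_sym lr rMi)).
  exact: (layer_trans lr r0q rq).
case: (ltngtP M q) Mq => // [Mq|Mq] _.
  have : k.+1 * M.+1 <= k.+1 * q by rewrite leq_mul2l Mq orbT.
  by rewrite mulnS; lia.
subst q; rewrite ltn_add2l; have : i != k; last by lia.
apply/eqP => ik'; subst i; have := max p pn (layer_trans lr rM rq); lia.
Qed.

(** The height stays at least [k] after the first letter, up to the letter
    [(k+1) M + 1], which is an R.  Before it, [a+1] up steps among the first
    [(k+1) a + 1] letters come from the points up to [a]; one more, needed as
    soon as a further letter is read, comes from the first point after [a] in
    the block of 0 in layer [k]. *)
Lemma word_split k n r M : 0 < k -> layered k r -> last_of_zero k n r M ->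
  exists v1 v2, [/\ path_word k n r = true :: v1 ++ false :: v2, size v1 = k.+1 * M,
    above_line k v1 & ~~ above_line k (v1 ++ [:: false])].
Proof.
move=> k0 lr LM; have [Mn rM max] := LM; set w := path_word k n r; set y := (k.+1 * M).+1.
have n0 : 0 < n by exact: leq_ltn_trans Mn.
have sw : size w = k.+1 * n by rewrite size_mkseq.
have yn : y < k.+1 * n.
  have : k.+1 * M.+1 <= k.+1 * n by rewrite leq_mul2l Mn orbT.
  by rewrite mulnS /y; lia.
have ny : nth false w y = false.
  rewrite nth_word //; apply/negP => /mapP[p]; rewrite mem_iota /= add0n => pn E.
  case: (leqP p M) => pM.
    have := up_step_le p lr; rewrite -E => h.
    have : k.+1 * p <= k.+1 * M by rewrite leq_mul2l pM orbT.
    by rewrite /y in h; lia.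
  by have := up_step_gt lr LM pM pn; rewrite -E /y addn1 ltnn.
have n0w : nth false w 0 by rewrite -(up_step0 k r) nth_word_step.
have [v Ev] : exists v, w = true :: v.
  by case: (w) n0w => [|[] v] // _; exists v.
set v1 := take (k.+1 * M) v; set v2 := drop y v.
have sv : (size v).+1 = k.+1 * n by rewrite -sw Ev.
have E : w = true :: v1 ++ false :: v2.
  rewrite {1}Ev -[in LHS](cat_take_drop (k.+1 * M) v) -/v1; congr (_ :: _ ++ _).
  rewrite (drop_nth false); last by rewrite -ltnS sv.
  by congr (_ :: _); have := ny; rewrite Ev.
have s1 : size v1 = k.+1 * M by rewrite size_takel // -ltnS sv ltnW.
have cnt l : l <= k.+1 * M ->
    (count_mem true (take l v1)).+1 = count (fun p => up_step k r p < l.+1) (iota 0 n).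
  move=> lM; rewrite -count_take_word //; last by apply: leq_ltn_trans lM (ltnW yn).
  rewrite -/w E /= add1n takel_cat ?s1 //.
have cE a l : a < n -> count (fun p => up_step k r p < l) (iota 0 n) =
    count (fun p => up_step k r p < l) (iota 0 a.+1) +
    count (fun p => up_step k r p < l) (iota a.+1 (n - a.+1)).
  by move=> an; rewrite -count_cat -iotaD subnKC.
have cfull a l : k.+1 * a < l ->
    count (fun p => up_step k r p < l) (iota 0 a.+1) = a.+1.
  move=> al; rewrite -[RHS](size_iota 0); apply/eqP; rewrite -all_count.
  apply/allP => p; rewrite mem_iota /= add0n ltnS => pa.
  apply: leq_ltn_trans al; apply: leq_trans (up_step_le _ lr) _.
  by rewrite leq_mul2l pa orbT.
exists v1, v2; split=> //.
  apply/above_lineP => i; set l := minn i (k.+1 * M).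
  have -> : take i v1 = take l v1 by rewrite /l -s1 take_min take_size.
  have lM : l <= k.+1 * M by apply: geq_minr.
  have := count_bool (take l v1); rewrite size_takel ?s1 // => sz.
  suff : l <= k.+1 * count_mem true (take l v1) by rewrite mulSn; lia.
  have := cnt _ lM; set c := count_mem true (take l v1) => Ec.
  set a := l %/ k.+1; have hl := divn_eq l k.+1; rewrite -/a in hl.
  have aM : a <= M by rewrite -(@leq_pmul2l k.+1) // mulnC; apply: leq_trans lM; apply: leq_divM.
  have an : a < n := leq_ltn_trans aM Mn.
  have al : k.+1 * a < l.+1 by rewrite ltnS mulnC leq_divM.
  rewrite (cE a) // cfull // in Ec.
  case: (posnP (l %% k.+1)) => lmod.
    rewrite hl lmod addn0 mulnC leq_mul2l; apply/orP; right; lia.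
  have {}aM : a < M.
    rewrite ltn_neqAle aM andbT; apply/eqP => aM'; move: lM; rewrite hl aM' mulnC; lia.
  have : has (fun p => up_step k r p < l.+1) (iota a.+1 (n - a.+1)).
    (* The first point after [a] in the block of 0; its predecessor in layer
       [k] is at most [a]. *)
    have ex : exists x, (a < x) && r k 0 x by exists M; rewrite aM.
    case: (ex_minnP ex) => x /andP[ax rx] mn.
    have xM : x <= M by apply: mn; rewrite aM.
    have xn := leq_ltn_trans xM Mn.
    apply/hasP; exists x; first by rewrite mem_iota; lia.
    have [|i' [q [[ik qx rq nq np] ->]]] := @up_stepP k r x lr; first by lia.
    have ek : i' = k.
      apply/eqP; rewrite eqn_leq ik leqNgt; apply/negP => lt.
      have /negP[] : ~~ r i'.+1 0 x by apply: np; lia.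
      exact: (layer_le lr lt).
    subst i'; have qa : q <= a.
      rewrite leqNgt; apply/negP => aq; have := mn q; rewrite aq leqNgt qx.
      by move=> /(_ (layer_trans lr rx (layer_sym lr rq))).
    have : k.+1 * q <= k.+1 * a by rewrite leq_mul2l qa orbT.
    by rewrite mulnC in al; rewrite subSnn; lia.
  rewrite has_count => h; rewrite hl mulnC.
  have : k.+1 * a.+1 <= k.+1 * c by rewrite leq_mul2l; apply/orP; right; lia.
  have := ltn_pmod l (ltn0Sn k); rewrite mulnS; lia.
apply/negP => /above_lineP/(_ (size v1).+1); rewrite take_oversize ?size_cat ?addn1 //.
rewrite !count_cat /=; have := count_bool v1; rewrite s1.
have := cnt _ (leqnn _); rewrite -{1}s1 take_size (cE M) // cfull //.
rewrite (_ : count _ (iota M.+1 _) = 0).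
  by rewrite addn0 => -[->]; rewrite mulSn !addn0 [M + _]addnC => /addIn->; rewrite addn1 ltnn.
apply/eqP; rewrite -leqn0 leqNgt -has_count; apply/hasPn => p.
rewrite mem_iota subnKC // => /andP[Mp pn].
by have := up_step_gt lr LM Mp pn; lia.
Qed.

Lemma last_of_zero_exists k n r : layered k r -> 0 < n -> exists M, last_of_zero k n r M.
Proof.
move=> lr n0.
have ex : exists x, (x < n) && r k 0 x by exists 0; rewrite n0 (layer_refl lr).
have ub x : (x < n) && r k 0 x -> x <= n by case/andP=> /ltnW.
case: (ex_maxnP ex ub) => m /andP[mn rm] mx; exists m; split=> // x xn rx.
by apply: mx; rewrite xn.
Qed.

(** Both words have [n] up steps, so it is enough that each up step of the
    promoted path is one of the lifted chain. *)
Lemma promotion_lifted k n r r' (p : kdyck k n) : 0 < k -> 0 < n ->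
  layered k r -> layered k r' -> lifted k n r r' ->
  dyck_word p = path_word k n r -> dyck_word (promotion p) = path_word k n r'.
Proof.
move=> k0 n0 lr lr' L Ep; have [M LM] := last_of_zero_exists lr n0.
have [v1 [v2 [Ew s1 A nA]]] := word_split k0 lr LM.
have Eq := promotion_word (etrans Ep Ew) A nA.
have /and3P[/eqP sq /eqP cq _] := dyck_wordP (promotion p).
apply: eq_of_count; first by rewrite size_mkseq.
  by rewrite count_word.
move=> y H; have [->|Hy] : y = k.+1 * M \/ nth false (path_word k n r) y.+1.
  move: H; rewrite Eq Ew /= !nth_cat s1; case: ltnP => h; first by right.
  case E: (y - k.+1 * M) => [|j] /=; first by left; lia.
  rewrite nth_cat; case: ltnP => // h'; first by right.
  by case: (j - size v2) => [|[]].
  have [Mn _ _] := LM; rewrite -(lift_step_zero k0 lr lr' L LM).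
  exact: nth_word_step.
have := Hy; rewrite nth_word; last by have := nth_true Hy; rewrite size_mkseq.
case/mapP=> x; rewrite mem_iota /= add0n => xn Ey.
have x0 : 0 < x by case: x Ey {xn} => //; rewrite up_step0.
have [x' xn' E] := lift_step k0 lr lr' L x0 xn.
by rewrite -[y]/(y.+1.-1) Ey -E nth_word_step.
Qed.

(** * Chains of set partitions as systems of layers *)

Definition layer_rel n (pi : seq {set {set 'I_n}}) : nat -> rel nat := fun j a b =>
  [|| j == 0, a == b
    | [exists x : 'I_n, exists y : 'I_n, [&& x == a :> nat, y == b :> nat & linked pi j x y]]].

Lemma linked_pblock n (pi : seq {set {set 'I_n}}) j x y : 0 < j ->
  is_chain setT pi -> linked pi j x y = (y \in pblock (nth (hat1 setT) pi j.-1) x).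
Proof.
move=> j0 cpi; rewrite same_blockP //; case: (ltnP j.-1 (size pi)) => h.
  exact: nth_partition.
by rewrite nth_default // hat1_partition.
Qed.

Lemma linked_refl n (pi : seq {set {set 'I_n}}) j x :
  0 < j -> is_chain setT pi -> linked pi j x x.
Proof.
move=> j0 cpi; rewrite linked_pblock // mem_pblock.
suff /and3P[/eqP-> _ _] : partition (nth (hat1 setT) pi j.-1) setT by rewrite inE.
case: (ltnP j.-1 (size pi)) => h; first exact: nth_partition.
by rewrite nth_default // hat1_partition.
Qed.

Lemma linked_trans n (pi : seq {set {set 'I_n}}) j x y z : 0 < j -> is_chain setT pi ->
  linked pi j x y -> linked pi j y z -> linked pi j x z.
Proof.
move=> j0 cpi; rewrite !linked_pblock // => xy.
suff /and3P[_ tri _] : partition (nth (hat1 setT) pi j.-1) setT by rewrite (same_pblock tri xy).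
case: (ltnP j.-1 (size pi)) => h; first exact: nth_partition.
by rewrite nth_default // hat1_partition.
Qed.

Lemma layer_relE n (pi : seq {set {set 'I_n}}) j (x y : 'I_n) :
  0 < j -> is_chain setT pi -> layer_rel pi j x y = linked pi j x y.
Proof.
move=> j0 cpi; rewrite /layer_rel eqn0Ngt j0 /=.
apply/orP/idP => [[/eqP/val_inj->|]|H].
- exact: linked_refl.
- by case/existsP=> x' /existsP[y' /and3P[/eqP/val_inj-> /eqP/val_inj->]].
by right; apply/existsP; exists x; apply/existsP; exists y; rewrite !eqxx.
Qed.

Lemma layer_rel_lt n (pi : seq {set {set 'I_n}}) j a b : 0 < j ->
  layer_rel pi j a b -> a = b \/ a < n /\ b < n.
Proof.
rewrite /layer_rel => /lt0n_neq0/negbTE-> /= /orP[/eqP|]; first by left.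
case/existsP=> x /existsP[y /and3P[/eqP<- /eqP<- _]]; right; split; exact: ltn_ord.
Qed.

Lemma layer_rel_ind n (pi : seq {set {set 'I_n}}) j (P : nat -> nat -> Prop) :
  0 < j -> is_chain setT pi -> (forall a, P a a) ->
  (forall x y : 'I_n, linked pi j x y -> P x y) ->
  forall a b, layer_rel pi j a b -> P a b.
Proof.
move=> j0 cpi P1 P2 a b H; case: (layer_rel_lt j0 H) => [->//|[an bn]].
by move: H; rewrite -[a]/(val (Ordinal an)) -[b]/(val (Ordinal bn)) layer_relE //; apply: P2.
Qed.

Lemma kchain_nc n (pi : seq {set {set 'I_n}}) : is_kchain pi -> nc_on setT pi.
Proof.
case/andP=> cpi /allP nc j a b c d j0 _ _ _ _ ab bc cd.
case: (leqP j (size pi)) => h; last first.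
  rewrite !linked_over // => /eqP E; have := ltn_trans ab bc; rewrite E ltnn //.
have /noncrossingP H : noncrossing (nth (hat1 setT) pi j.-1).
  by apply: nc; rewrite mem_nth // prednK.
case/exists_inP=> B BP /andP[aB cB] /exists_inP[C CP /andP[bC dC]].
apply/exists_inP; exists B => //; rewrite aB.
by rewrite (H _ _ _ _ _ _ BP CP aB cB bC dC ab bc cd).
Qed.

Lemma layered_layer_rel k n (pi : kchain k n) : layered k (layer_rel pi).
Proof.
have kpi := layersP pi; have /andP[cpi _] := kpi.
have szpi : size pi = k by rewrite size_tuple.
split.
- by move=> [|j] x; rewrite /layer_rel eqxx ?orbT.
- move=> [|j] a b //; elim/layer_rel_ind => // {a b} [a|x y].
    by rewrite /layer_rel eqxx orbT.
  by rewrite layer_relE // linked_sym.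
- move=> [|j] a b c // ab bc.
  case: (layer_rel_lt (ltn0Sn j) ab) => [->//|[an bn]].
  case: (layer_rel_lt (ltn0Sn j) bc) => [<-//|[_ cn]].
  move: ab bc; rewrite -[a]/(val (Ordinal an)) -[b]/(val (Ordinal bn)) -[c]/(val (Ordinal cn)).
  by rewrite !layer_relE //; apply: linked_trans.
- by move=> x y; rewrite /layer_rel eqxx.
- move=> a b; elim/layer_rel_ind => // x y.
  by rewrite linked_over ?szpi // => /eqP->.
- move=> [|j] a b; first by rewrite /layer_rel eqxx.
  elim/layer_rel_ind => // {a b} [a|x y H].
    by rewrite /layer_rel eqxx orbT.
  by rewrite layer_relE //; apply: (linked_mono cpi _ _ H); rewrite ?inE.
- move=> [|j] a b c d ab bc cd ac bd; first by rewrite /layer_rel eqxx.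
  case: (layer_rel_lt (ltn0Sn j) ac) => [E|[an cn]].
    by have := ltn_trans ab bc; rewrite E ltnn.
  case: (layer_rel_lt (ltn0Sn j) bd) => [E|[bn dn]].
    by have := ltn_trans bc cd; rewrite E ltnn.
  move: ac bd; rewrite -[a]/(val (Ordinal an)) -[b]/(val (Ordinal bn)).
  rewrite -[c]/(val (Ordinal cn)) -[d]/(val (Ordinal dn)).
  rewrite !layer_relE //; apply: (kchain_nc kpi); rewrite ?inE //.
Qed.

Lemma rankT n (x : 'I_n) : rank [set: 'I_n] x = x.
Proof.
case: x => x /=; elim: x => [|x IH] xn.
  by apply: rank_min => y _; rewrite ltn0.
rewrite -[x.+1]/(val (Ordinal xn)) (@rank_next _ _ (Ordinal (ltnW xn))) ?inE //=.
  by rewrite IH // ltnW.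
by move=> y _; lia.
Qed.

Lemma NCPtoDyck_up_steps k n (pi : kchain k n) :
  dyck_word (NCPtoDyck pi) = path_word k n (layer_rel pi).
Proof.
have kpi := layersP pi; have /andP[cpi _] := kpi.
have szpi : size pi = k by rewrite size_tuple.
have /and3P[/eqP sz /eqP ct _] := dyck_wordP (NCPtoDyck pi).
have lr := layered_layer_rel pi; apply: word_unique => // p pn.
have [_ H] : realizes k pi setT (NCPtoDyck_word k setT pi).
  apply: (@realizes_rec _ _ _ k) => //; first exact: kchain_nc.
    by rewrite /trivial_from szpi leqnn drop_oversize ?szpi.
  by rewrite /enough_fuel szpi leq_addr.
apply: (H (Ordinal pn)); rewrite ?inE //.
have lE j (x : 'I_n) : 0 < j -> linked pi j x (Ordinal pn) = layer_rel pi j x p.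
  by move=> j0; rewrite -layer_relE.
case: (posnP p) => [p0|p0].
  left; split=> [|x _ /= xp]; last by lia.
  by rewrite rankT /= p0 up_step0 muln0.
have [i [q [[ik qp rq nq np] ->]]] := up_stepP lr p0.
case: (posnP i) => [i0|i0].
  subst i; have qe : q.+1 = p.
    apply/eqP; rewrite eqn_leq qp leqNgt; apply/negP => qp'.
    by have := nq q.+1; rewrite ltnSn qp' => /(_ isT).
  left; split=> [|x _ xp]; last by rewrite lE // np.
  by rewrite rankT /= -qe mulnS; lia.
right; exists i, (Ordinal (ltn_trans qp pn)); split.
  by split; rewrite ?inE ?i0 ?lE.
split=> [x _ h|x _ xp|]; last by rewrite rankT.
  by rewrite lE // nq.
by rewrite lE // np.
Qed.

Section ChainOfRel.
Variables (k n : nat) (r : nat -> rel nat).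
Hypothesis lr : layered k r.

Definition layers_of : k.-tuple {set {set 'I_n}} :=
  [tuple equivalence_partition (fun x y : 'I_n => r i.+1 x y) [set: 'I_n] | i < k].

Lemma layer_equiv j : {in [set: 'I_n] & &, equivalence_rel (fun x y : 'I_n => r j x y)}.
Proof.
move=> x y z _ _ _; split; first exact: (layer_refl lr).
move=> xy; apply/idP/idP; last exact: (layer_trans lr xy).
exact: (layer_trans lr (layer_sym lr xy)).
Qed.

Lemma nth_layers_of j : j < k -> nth (hat1 [set: 'I_n]) layers_of j =
  equivalence_partition (fun x y : 'I_n => r j.+1 x y) setT.
Proof.
by move=> jk; rewrite -(tnth_nth _ _ (Ordinal jk)) tnth_mktuple.
Qed.

Lemma mem_layer_of j B (x y : 'I_n) :
  B \in equivalence_partition (fun x y : 'I_n => r j x y) setT -> x \in B ->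
  (y \in B) = r j x y.
Proof.
move=> BP xB; have /and3P[_ tri _] := equivalence_partitionP (layer_equiv j).
by rewrite -(def_pblock tri BP xB) (pblock_equivalence_partition (layer_equiv j)) ?inE.
Qed.

Lemma layers_of_kchain : is_kchain layers_of.
Proof.
have kP (P : pred {set {set 'I_n}}) :
    (forall i, i < k -> P (equivalence_partition (fun x y : 'I_n => r i.+1 x y) setT)) ->
    all P layers_of.
  by move=> H; apply/all_tnthP => i; rewrite tnth_mktuple; apply: H.
have part i := equivalence_partitionP (layer_equiv i).
apply/andP; split; last first.
  apply: kP => i ik; apply/noncrossingP => B C a c b d BP CP aB cB bC dC ab bc cd.
  have /and3P[_ tri _] := part i.+1.
  rewrite -(def_pblock tri BP aB) -(def_pblock tri CP bC); apply: same_pblock => //.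
  rewrite (def_pblock tri CP bC) (mem_layer_of _ CP bC); apply: (layer_sym lr).
  by apply: (layer_nc lr ab bc cd); rewrite -?(mem_layer_of _ BP aB) -?(mem_layer_of _ CP bC).
apply/andP; split; first by apply: kP => i _; apply: part.
apply/(sortedP (hat1 setT)) => i; rewrite size_tuple => ik.
rewrite !nth_layers_of //; last exact: ltnW.
apply/forall_inP => B BP.
have /and3P[_ _ n0] := part i.+2; have /and3P[/eqP cov tri _] := part i.+1.
have /set0Pn[u uB] : B != set0 by apply: contraNneq n0 => <-.
apply/exists_inP; exists (pblock (equivalence_partition (fun x y : 'I_n => r i.+1 x y) setT) u).
  by rewrite pblock_mem // cov inE.
apply/subsetP => v; rewrite (mem_layer_of _ BP uB).
rewrite (pblock_equivalence_partition (layer_equiv i.+1)) ?inE //.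
exact: (layer_succ lr).
Qed.

Lemma layer_rel_layers_of j x y : x < n -> y < n -> layer_rel layers_of j x y = r j x y.
Proof.
move=> xn yn; have /andP[cpi _] := layers_of_kchain.
case: j => [|j]; first by rewrite /layer_rel (layer_top lr).
rewrite -[x]/(val (Ordinal xn)) -[y]/(val (Ordinal yn)) layer_relE //.
case: (ltnP j k) => jk.
  by rewrite linked_pblock //= nth_layers_of // (pblock_equivalence_partition (layer_equiv _)) ?inE.
rewrite linked_over ?size_tuple //.
apply/eqP/idP => [/(congr1 val) /= ->|]; first exact: (layer_refl lr).
by move/(layer_le lr (jk : k < j.+1))/(layer_bot lr) => E; apply: val_inj.
Qed.
End ChainOfRel.

Lemma layer_rel_inj k n (pi rho : kchain k n) :
  (forall j x y, x < n -> y < n -> layer_rel pi j x y = layer_rel rho j x y) -> pi = rho.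
Proof.
move=> E; apply/val_inj/eq_from_tnth => i.
have /andP[cpi _] := layersP pi; have /andP[crho _] := layersP rho.
have nE (s : kchain k n) : tnth s i = nth (hat1 setT) s i by apply: tnth_nth.
have P (s : kchain k n) : partition (tnth s i) setT.
  have /andP[cs _] := layersP s; rewrite nE; apply: nth_partition => //.
  by rewrite size_tuple.
rewrite -[LHS](equivalence_partition_pblock (P pi)) -[RHS](equivalence_partition_pblock (P rho)).
apply: eq_in_imset => x _; apply/setP => y; rewrite !inE !nE.
rewrite -[nat_of_ord i]/(i.+1.-1) -!(@linked_pblock _ _ i.+1) // -!layer_relE //.
exact: E.
Qed.

Lemma NCPtoDyck_inj k n : injective (@NCPtoDyck k n).
Proof.
move=> pi rho E; apply: layer_rel_inj; apply: (@word_inj k); try exact: layered_layer_rel.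
by rewrite -!NCPtoDyck_up_steps E.
Qed.

Lemma NCPtoDyck_surj k n (p : kdyck k n) : exists pi : kchain k n, NCPtoDyck pi == p.
Proof.
have [r lr rp] := word_surj (dyck_wordP p).
exists (KChain (layers_of_kchain n lr)); apply/eqP/val_inj => /=.
rewrite -[LHS]/(dyck_word (NCPtoDyck (KChain (layers_of_kchain n lr)))) NCPtoDyck_up_steps.
by rewrite -[RHS]rp; apply: eq_word => j x y; apply: layer_rel_layers_of.
Qed.

Lemma all_pblock_take n (pi : seq {set {set 'I_n}}) j (x y : 'I_n) :
  is_chain setT pi -> j <= size pi ->
  all (fun P => y \in pblock P x) (take j pi) = layer_rel pi j x y.
Proof.
move=> cpi; elim: j => [|j IH] js; first by rewrite take0.
rewrite (take_nth (hat1 setT)) // all_rcons IH 1?ltnW // [RHS]layer_relE //.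
rewrite -[j in nth _ _ j]/(j.+1.-1) -(@linked_pblock _ _ j.+1) //.
case: (boolP (linked pi j.+1 x y)) => //= H.
case: j {IH js} H => // j H; rewrite layer_relE //.
by apply: (linked_mono cpi _ _ H); rewrite ?inE.
Qed.

Lemma lifted_Lift k n (pi : kchain k n) : 0 < k ->
  lifted k n (layer_rel pi) (layer_rel (Lift pi)).
Proof.
move=> k0 j x y jk xy yn; have /andP[cpi _] := layersP pi.
have /andP[cL _] := layersP (Lift pi).
have szpi : size pi = k by rewrite size_tuple.
have jpi : j < size pi by rewrite szpi.
have xn := ltn_trans xy yn.
set u := Ordinal xn; set v := Ordinal yn.
have -> : layer_rel (Lift pi) j.+1 x y = lift_rel pi j.+1 u v.
  rewrite -[x]/(val u) -[y]/(val v) layer_relE // linked_pblock //.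
  have -> : nth (hat1 setT) (Lift pi) j.+1.-1 = lift_layer pi j.+1.
    by rewrite -(tnth_nth _ _ (Ordinal jk)) tnth_mktuple.
  by rewrite (pblock_equivalence_partition (lift_rel_equiv cpi jpi)) ?inE.
rewrite lift_relE // all_pblock_take 1?ltnW //.
have xorE a : (x < a) (+) (y < a) = (x < a <= y) by lia.
have lastE : last (hat1 setT) pi = nth (hat1 setT) pi k.-1.
  by rewrite -nth_last szpi.
split=> [/andP[/edge_keptP H ->]|[H ->]].
  split=> // a b an bn; rewrite -[a]/(val (Ordinal an)) -[b]/(val (Ordinal bn)) layer_relE //.
  case/exists_inP=> B; rewrite -lastE => BP /andP[aB bB].
  by rewrite -!xorE; apply: (H B).
rewrite andbT; apply/edge_keptP => B a b BP aB bB; rewrite /= !xorE.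
apply: H => //; rewrite layer_relE //; apply/exists_inP; exists B; rewrite ?aB //.
by rewrite -lastE.
Qed.

Theorem proposition6p24 (n k : nat) (hn : 0 < n) (hk : 0 < k) :
  exists NCPtoDyck_inv : kdyck k n -> kchain k n,
    [/\ cancel (@NCPtoDyck k n) NCPtoDyck_inv,
        cancel NCPtoDyck_inv (@NCPtoDyck k n)
      & forall pi : kchain k n,
          Lift pi = NCPtoDyck_inv (promotion (NCPtoDyck pi))].
Proof.
pose inv (p : kdyck k n) : kchain k n := xchoose (NCPtoDyck_surj p).
have invK : cancel inv (@NCPtoDyck k n).
  by move=> p; apply/eqP; apply: (xchooseP (NCPtoDyck_surj p)).
have Kinv : cancel (@NCPtoDyck k n) inv by move=> pi; apply: NCPtoDyck_inj.
exists inv; split=> // pi; apply: NCPtoDyck_inj; rewrite invK; apply: val_inj.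
rewrite -[LHS]/(dyck_word _) -[RHS]/(dyck_word _) NCPtoDyck_up_steps.
apply/esym/(promotion_lifted hk hn (layered_layer_rel pi) (layered_layer_rel (Lift pi))).
  exact: lifted_Lift.
exact: NCPtoDyck_up_steps.
Qed.
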